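(* Let $(\mathcal E,i)$ be a prop with $A_\infty$-multiplication, let $C\mathcal E$ be its Hochschild core category and let $C\mathcal E\hookrightarrow\widetilde{\mathcal E}$ be an extension of $C\mathcal E$. Then $\widetilde{\mathcal E}$ acts naturally on the Hochschild complex of $\mathcal E$-algebras: for any $\mathcal E$-algebra $A$ (i.e. $A=\Phi(1)$ for a split symmetric monoidal functor $\Phi:\mathcal E\to\mathrm{Ch}$), with $C(A,A)=C(\Phi)(0)$ its Hochschild complex, there are chain maps $$C(A,A)^{\otimes n_1}\otimes A^{\otimes m_1}\otimes \widetilde{\mathcal E}([m_1;n_1],[m_2;n_2])\ \longrightarrow\ C(A,A)^{\otimes n_2}\otimes A^{\otimes m_2}$$ for all $m_1,n_1,m_2,n_2\ge 0$, which are natural in $A$ and associative with respect to composition in $\widetilde{\mathcal E}$.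
   Context: Conventions. $\mathrm{Ch}$ is the category of chain complexes over $\mathbb Z$ (usual Koszul signs). A dg-category is a category enriched in $\mathrm{Ch}$, with composition written $\mathcal E(m,n)\otimes\mathcal E(n,p)\to\mathcal E(m,p)$. A dg-functor $\Phi:\mathcal E\to\mathrm{Ch}$ (simply ''functor'') has structure chain maps $c_\Phi:\Phi(m)\otimes\mathcal E(m,n)\to\Phi(n)$. A prop is a symmetric monoidal dg-category with objects $0,1,2,\dots$ and monoidal product $+$ on objects. A functor $\Phi$ is monoidal if equipped with natural maps $\Phi(n)\otimes\Phi(m)\to\Phi(n+m)$, symmetric monoidal if these are compatible with symmetries, and split (resp. h-split) if these maps are isomorphisms (resp. quasi-isomorphisms). The prop $A_\infty$. $A_\infty(m,n)$ is the chain complex generated by isomorphism classes of oriented planar forests consisting of $n$ trees, each with one root (outgoing leaf) and at least one incoming leaf, all vertices of valence $\ge 3$ (the tree with no vertex is allowed), with incoming leaves labeled $1,\dots,m$ and roots labeled $1,\dots,n$. An orientation of a graph with vertex set $V$ and half-edge set $H$ is a unit vector in $\det(\mathbb R(V\sqcup H))$, and $-1$ is identified with reversing orientation. The degree is $\sum_v(|v|-3)$. The differential of $G$ is the sum of all blow-ups, i.e. $\sum\tilde G$ over pairs $(\tilde G,e)$, $e$ an internal edge with $\tilde G/e=G$; if $e=\{h_1,h_2\}$ joins $v_1,v_2$, the orientation $v_1\wedge v_2\wedge h_1\wedge h_2\wedge x$ of $\tilde G$ collapses to $v\wedge x$, $v$ the new vertex. Composition grafts roots to leaves with the same label, wedging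 orientations; the monoidal structure is disjoint union. A prop with $A_\infty$-multiplication is a pair $(\mathcal E,i)$ with $\mathcal E$ a prop and $i:A_\infty\to\mathcal E$ a symmetric monoidal dg-functor which is the identity on objects. Hochschild complex. Let $l_n$ ($n\ge1$) be the graph with one white vertex $w$ and $n$ leaves $h_1,\dots,h_n$ in this cyclic order, $h_1$ being the distinguished start leaf, with orientation $w\wedge h_1\wedge\dots\wedge h_n$ and degree $n-1$; $L_n=\mathbb Z l_n$. Its differential is the sum of its blow-ups: for $2\le r\le n$, $1\le j\le n$, the leaves $h_j,\dots,h_{j+r-1}$ (indices mod $n$) are moved to a new black vertex joined to $w$ by a new edge (which becomes the start half-edge at $w$ if $h_1$ is among the moved leaves), oriented so that collapsing the new edge (by the rule above) returns the orientation of $l_n$. Cutting around $w$, each blow-up is a forest in $A_\infty(n,k)$, $k=n+1-r$, grafted on $l_k$ (orientation of the forest wedge that of $l_k$), so the differential is written $d_L(l_n)=\sum_{k<n}f_{n,k}\otimes l_k$ with $f_{n,k}\in A_\infty(n,k)$. For a functor $\Phi:\mathcal E\to\mathrm{Ch}$, its Hochschild complex is the functor $C(\Phi):\mathcal E\to\mathrm{Ch}$ with $$C(\Phi)(m)=\bigoplus_{n\ge1}\Phi(n+m)\otimes L_n,\quad d(x\otimes l_n)=d_\Phi x\otimes l_n+(-1)^{|x|}\sum_{k<n}\Phi(i(f_{n,k})+id_m)(x)\otimes l_k,$$ and a morphism $f$ of $\mathcal E$ acting by $\Phi(id_n+f)$ on the first factor (with Koszul sign $(-1)^{(n-1)|f|}$).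 $C^n(\Phi)$ denotes the $n$-fold iterate and $C^0$ the identity; thus $C^n(\Phi)(m)=\bigoplus\Phi(k_1+\dots+k_n+m)\otimes L_{k_1}\otimes\dots\otimes L_{k_n}$. For $\Phi$ symmetric monoidal, $C(\Phi)(0)$ is the usual Hochschild complex of the $A_\infty$-algebra $\Phi(1)$. Hochschild core category and extensions. $C\mathcal E$ has objects pairs of natural numbers $[m;n]$ and morphisms $C\mathcal E([m_1;0],[m_2;n_2])=C^{n_2}(\mathcal E(m_1,-))(m_2)$, and (apart from identities) $C\mathcal E([m_1;n_1],[m_2;n_2])=0$ for $n_1\ne0$; in particular $C\mathcal E([m_1;0],[m_2;0])=\mathcal E(m_1,m_2)$. Composition is induced by composition in $\mathcal E$ (the complexes $C^n(\mathcal E(m_1,-))(m_2)$ being functorial in $m_1$ and $m_2$). The monoidal structure is addition of pairs, with the maps $C^{n}(\mathcal E(m_1,-))(m_2)\otimes C^{n'}(\mathcal E(m_1',-))(m_2')\to C^{n+n'}(\mathcal E(m_1+m_1',-))(m_2+m_2')$ given by permuting factors and the monoidal structure of $\mathcal E$. An extension of $C\mathcal E$ is a monoidal dg-category $\widetilde{\mathcal E}$ with objects the pairs $[m;n]$ and a monoidal inclusion $C\mathcal E\hookrightarrow\widetilde{\mathcal E}$ such that $\widetilde{\mathcal E}([m_1;0],[m_2;n_2])=C\mathcal E([m_1;0],[m_2;n_2])$. *)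

(* Defs.v *)
From HB Require Import structures.
From mathcomp Require Import all_boot all_order all_algebra.
From mathcomp Require Import boolp.

Set Implicit Arguments.
Unset Strict Implicit.
Unset Printing Implicit Defensive.

Import GRing.Theory.
Local Open Scope ring_scope.

(** * Additive and biadditive maps *)

Section MkAdditive.
Variables (A B : zmodType) (f : A -> B) (fD : {morph f : x y / x + y}).

Lemma mkadd_subproof : nmod_morphism f.
Proof. by split=> //; apply: (addIr (f 0)); rewrite -fD !add0r. Qed.

Definition mkadd : {additive A -> B} :=
  HB.pack_for {additive A -> B} f
    (GRing.isNmodMorphism.Build A B f mkadd_subproof).

End MkAdditive.

Record biadd (A B C : zmodType) := Biadd {
  biadd_fun :> A -> B -> C;
  biaddl : forall y, {morph biadd_fun^~ y : x x' / x + x'};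
  biaddr : forall x, {morph biadd_fun x : y y' / y + y'} }.

Section BiaddTheory.
Variables A B C : zmodType.
Implicit Type f : biadd A B C.

Definition bi_l f (y : B) : {additive A -> C} := mkadd (biaddl f y).
Definition bi_r f (x : A) : {additive B -> C} := mkadd (biaddr f x).

Lemma bi0l f y : f 0 y = 0. Proof. exact: raddf0 (bi_l f y). Qed.
Lemma bi0r f x : f x 0 = 0. Proof. exact: raddf0 (bi_r f x). Qed.
Lemma biNl f x y : f (- x) y = - f x y. Proof. exact: raddfN (bi_l f y) x. Qed.
Lemma bi_suml f (I : Type) (s : seq I) (P : pred I) (F : I -> A) y :
  f (\sum_(i <- s | P i) F i) y = \sum_(i <- s | P i) f (F i) y.
Proof. exact: raddf_sum (bi_l f y) _ _ _ _. Qed.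
Lemma bi_sumr f (I : Type) (s : seq I) (P : pred I) (F : I -> B) x :
  f x (\sum_(i <- s | P i) F i) = \sum_(i <- s | P i) f x (F i).
Proof. exact: raddf_sum (bi_r f x) _ _ _ _. Qed.

Lemma bi_post_subproofl D (g : {additive C -> D}) f y :
  {morph (fun x => g (f x y)) : x x' / x + x'}.
Proof. by move=> x x'; rewrite biaddl raddfD. Qed.
Lemma bi_post_subproofr D (g : {additive C -> D}) f x :
  {morph (fun y => g (f x y)) : y y' / y + y'}.
Proof. by move=> y y'; rewrite biaddr raddfD. Qed.
Definition bi_post (D : zmodType) (g : {additive C -> D}) f : biadd A B D :=
  Biadd (bi_post_subproofl g f) (bi_post_subproofr g f).

Lemma bi_pre_subproofl A' B' (h : {additive A' -> A}) (k : {additive B' -> B})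
  f y : {morph (fun x => f (h x) (k y)) : x x' / x + x'}.
Proof. by move=> x x'; rewrite raddfD biaddl. Qed.
Lemma bi_pre_subproofr A' B' (h : {additive A' -> A}) (k : {additive B' -> B})
  f x : {morph (fun y => f (h x) (k y)) : y y' / y + y'}.
Proof. by move=> y y'; rewrite raddfD biaddr. Qed.
Definition bi_pre (A' B' : zmodType)
    (h : {additive A' -> A}) (k : {additive B' -> B}) f : biadd A' B' C :=
  Biadd (bi_pre_subproofl h k f) (bi_pre_subproofr h k f).

Definition bi_flip f : biadd B A C :=
  @Biadd B A C (fun y x => f x y) (biaddr f) (biaddl f).

End BiaddTheory.

(** * Graded abelian groups with a differential *)

(* A graded abelian group is encoded by its total group (the direct sum of its
   components) together with the projections [pr p] onto the components; the
   component of degree p is the image of [pr p], see [homog].  The conditions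
   on the differential itself are in [is_complex]. *)
Record precomplex := Precomplex {
  pc_car :> zmodType;
  pr : int -> {additive pc_car -> pc_car};
  pr_pr : forall p q x, pr p (pr q x) = if p == q then pr p x else 0;
  pr_sum : forall x, exists2 s : seq int, uniq s & x = \sum_(p <- s) pr p x;
  df : {additive pc_car -> pc_car} }.

Arguments pr {p} _ : rename.
Arguments df {p} : rename.

Definition homog (C : precomplex) (p : int) (x : C) : Prop := pr p x = x.

Record is_complex (C : precomplex) : Prop := {
  df_pr : forall (p : int) (x : C), df (pr p x) = pr (p - 1) (df x);
  df_df : forall x : C, df (df x) = 0 }.

Record chain_map (C D : precomplex) := ChainMap {
  chain_fun :> {additive C -> D};
  chain_pr : forall p x, chain_fun (pr p x) = pr p (chain_fun x);
  chain_df : forall x, chain_fun (df x) = df (chain_fun x) }.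

Section Support.
Variable C : precomplex.
Implicit Type x : C.

Definition supp x : seq int := s2val (cid2 (pr_sum x)).
Lemma supp_uniq x : uniq (supp x). Proof. exact: s2valP (cid2 (pr_sum x)). Qed.
Lemma suppE x : x = \sum_(p <- supp x) pr p x.
Proof. exact: s2valP' (cid2 (pr_sum x)). Qed.

Lemma supp_out x p : p \notin supp x -> pr p x = 0.
Proof.
move=> pNx; rewrite [in LHS](suppE x) raddf_sum big1_seq //= => q /= qx.
by rewrite pr_pr; case: eqP pNx => // ->; rewrite qx.
Qed.

Lemma sum_sub (W : zmodType) (F : int -> W) (s t : seq int) :
  uniq s -> uniq t -> {subset s <= t} -> (forall p, p \notin s -> F p = 0) ->
  \sum_(p <- t) F p = \sum_(p <- s) F p.
Proof.
move=> us ut st F0; rewrite (bigID (mem s)) /= [X in _ + X]big1 ?addr0 //.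
rewrite -big_filter; apply/perm_big/uniq_perm; rewrite ?filter_uniq // => p.
by rewrite mem_filter andb_idr //; apply: st.
Qed.

Lemma sum_supp (W : zmodType) (F : int -> C -> W) x t :
  (forall p, F p 0 = 0) -> uniq t -> {subset supp x <= t} ->
  \sum_(p <- supp x) F p (pr p x) = \sum_(p <- t) F p (pr p x).
Proof.
move=> F0 ut st; rewrite (sum_sub (supp_uniq x) ut) // => p pN.
by rewrite supp_out.
Qed.

Lemma sum_supp_add (W : zmodType) (F : int -> C -> W) :
  (forall p, {morph F p : x y / x + y}) ->
  {morph (fun x => \sum_(p <- supp x) F p (pr p x)) : x y / x + y}.
Proof.
move=> FD x y; have F0 p : F p 0 = 0 := raddf0 (mkadd (FD p)).
pose t := undup (supp x ++ supp y ++ supp (x + y)).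
have ut : uniq t := undup_uniq _.
have inT z : {subset supp z <= supp x ++ supp y ++ supp (x + y)} ->
  {subset supp z <= t} by move=> sz p pz; rewrite mem_undup; apply: sz.
rewrite !(@sum_supp _ _ _ t) //; last 3 first.
- by apply: inT => p pz; rewrite !mem_cat pz !orbT.
- by apply: inT => p pz; rewrite !mem_cat pz ?orbT.
- by apply: inT => p pz; rewrite !mem_cat pz ?orbT.
by rewrite -big_split; apply: eq_bigr => p _; rewrite raddfD FD.
Qed.

(* The grading involution x |-> (-1)^|x| x. *)
Definition eps_fun x : C := \sum_(p <- supp x) pr p x *~ (-1) ^+ `|p|%N.
Lemma eps_fun_subproof : {morph eps_fun : x y / x + y}.
Proof.
apply: (@sum_supp_add _ (fun p x => x *~ (-1) ^+ `|p|%N)) => p x y.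
exact: mulrzDl.
Qed.
Definition eps : {additive C -> C} := mkadd eps_fun_subproof.

Definition epsn (n : nat) : {additive C -> C} :=
  if odd n then eps else idfun.

End Support.

(* The sign (-1)^(pq). *)
Definition ksign (p q : int) : int := (-1) ^+ (`|p| * `|q|)%N.

(* Chain maps A (x) B -> C, as biadditive maps. *)
Record bichain (A B C : precomplex) (f : biadd A B C) : Prop := {
  bichain_homog : forall p q x y, homog p x -> homog q y -> homog (p + q) (f x y);
  bichain_df : forall x y, df (f x y) = f (df x) y + f (eps A x) (df y) }.

(** ** Groups concentrated in degree 0 *)

Section Deg0.
Variable A : zmodType.

Definition deg0_pr_fun (p : int) (x : A) : A := if p == 0 then x else 0.
Lemma deg0_pr_subproof p : {morph deg0_pr_fun p : x y / x + y}.
Proof. by rewrite /deg0_pr_fun => x y; case: eqP => _; rewrite ?addr0. Qed.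
Definition deg0_pr p : {additive A -> A} := mkadd (@deg0_pr_subproof p).

Lemma deg0_pr_pr p q x :
  deg0_pr p (deg0_pr q x) = if p == q then deg0_pr p x else 0.
Proof.
rewrite /= /deg0_pr_fun; case: eqVneq => [->|p0]; last by case: ifP.
by rewrite eq_sym.
Qed.
Lemma deg0_pr_sum x : exists2 s : seq int, uniq s & x = \sum_(p <- s) deg0_pr p x.
Proof. by exists [:: 0] => //; rewrite big_seq1. Qed.

Definition deg0 : precomplex := Precomplex deg0_pr_pr deg0_pr_sum \0.

End Deg0.

(** ** Tensor products *)

Section ZTensor.
Variables A B : zmodType.

(* The tensor product of abelian groups: formal sums of pairs, modulo the
   congruence generated by biadditivity. *)
Inductive tens_rel : seq (A * B) -> seq (A * B) -> Prop :=
| tens_refl s : tens_rel s s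
| tens_sym s t : tens_rel s t -> tens_rel t s
| tens_trans s t u : tens_rel s t -> tens_rel t u -> tens_rel s u
| tens_cat s s' t t' :
    tens_rel s s' -> tens_rel t t' -> tens_rel (s ++ t) (s' ++ t')
| tens_catC s t : tens_rel (s ++ t) (t ++ s)
| tens_addl a a' b : tens_rel [:: (a + a', b)] [:: (a, b); (a', b)]
| tens_addr a b b' : tens_rel [:: (a, b + b')] [:: (a, b); (a, b')]
| tens_0l b : tens_rel [:: (0, b)] [::].

Definition tens_relb (s t : seq (A * B)) : bool := `[< tens_rel s t >].
Lemma tens_relb_refl : reflexive tens_relb.
Proof. by move=> s; apply/asboolP/tens_refl. Qed.
Lemma tens_relb_sym : symmetric tens_relb.
Proof. by move=> s t; apply/asboolP/asboolP; apply: tens_sym. Qed.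
Lemma tens_relb_trans : transitive tens_relb.
Proof. by move=> t s u /asboolP st /asboolP tu; apply/asboolP/tens_trans/tu. Qed.
Canonical tens_equiv :=
  EquivRel tens_relb tens_relb_refl tens_relb_sym tens_relb_trans.

Definition ztens : Type := {eq_quot tens_equiv}%qT.
HB.instance Definition _ := Choice.on ztens.
HB.instance Definition _ := EqQuotient.on ztens.

Definition zt_class (s : seq (A * B)) : ztens := (\pi_ztens s)%qT.

Lemma zt_classP s t : zt_class s = zt_class t <-> tens_rel s t.
Proof.
by split=> [/eqmodP /asboolP | st] //; apply/eqmodP/asboolP.
Qed.

Lemma zt_repr (t : ztens) : zt_class (repr t) = t. Proof. exact: reprK. Qed.
Lemma zt_reprP s : tens_rel (repr (zt_class s)) s.
Proof. by apply/zt_classP; rewrite zt_repr. Qed.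

Definition zt_add (t u : ztens) : ztens := zt_class (repr t ++ repr u).
Definition zt_opp (t : ztens) : ztens :=
  zt_class [seq (- p.1, p.2) | p <- repr t].

Lemma zt_addE s t : zt_add (zt_class s) (zt_class t) = zt_class (s ++ t).
Proof. by apply/zt_classP/tens_cat; apply: zt_reprP. Qed.

Lemma zt_addA : associative zt_add.
Proof.
move=> t u v; rewrite -[t]zt_repr -[u]zt_repr -[v]zt_repr.
by rewrite !zt_addE catA.
Qed.
Lemma zt_addC : commutative zt_add.
Proof.
move=> t u; rewrite -[t]zt_repr -[u]zt_repr.
by rewrite !zt_addE; apply/zt_classP/tens_catC.
Qed.
Lemma zt_add0 : left_id (zt_class [::]) zt_add.
Proof. by move=> t; rewrite -[t]zt_repr zt_addE. Qed.
Lemma zt_addN : left_inverse (zt_class [::]) zt_opp zt_add.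
Proof.
move=> t; rewrite -[X in zt_add _ X]zt_repr zt_addE; apply/zt_classP.
elim: (repr t) => [|[a b] s IHs] /=; first exact: tens_refl.
have step : tens_rel ([:: (- a, b)] ++ ([seq (- p.1, p.2) | p <- s] ++ (a, b) :: s))
                     ([:: (- a, b)] ++ ((a, b) :: s ++ [seq (- p.1, p.2) | p <- s])).
  by apply: tens_cat; [exact: tens_refl|rewrite -cat_cons; exact: tens_catC].
apply: (tens_trans step) => {step}.
rewrite -[X in tens_rel X]/([:: (- a, b); (a, b)] ++ _) -[X in tens_rel _ X]cat0s.
apply: tens_cat; last by apply: tens_trans IHs; apply: tens_catC.
by apply: tens_trans (tens_0l b); rewrite -(addNr a); apply/tens_sym/tens_addl.
Qed.
HB.instance Definition _ :=
  GRing.isZmodule.Build ztens zt_addA zt_addC zt_add0 zt_addN.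

Lemma tpair_subproofl b : {morph (fun a => zt_class [:: (a, b)]) : x y / x + y}.
Proof. by move=> x y; rewrite [RHS]zt_addE; apply/zt_classP/tens_addl. Qed.
Lemma tpair_subproofr a : {morph (fun b => zt_class [:: (a, b)]) : x y / x + y}.
Proof. by move=> x y; rewrite [RHS]zt_addE; apply/zt_classP/tens_addr. Qed.
Definition tpair : biadd A B ztens := Biadd tpair_subproofl tpair_subproofr.

Section Lift.
Variables (C : zmodType) (f : biadd A B C).

Definition tlift_fun (t : ztens) : C := \sum_(p <- repr t) f p.1 p.2.

Lemma tlift_class s : tlift_fun (zt_class s) = \sum_(p <- s) f p.1 p.2.
Proof.
rewrite /tlift_fun; move: (repr _) (zt_reprP s) => t0.
elim=> {s t0} [s|s t _ -> //|s t u _ -> _ -> //|s s' t t' _ es _ et|s t|a a' b|a b b'|b].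
- by [].
- by rewrite !big_cat es et.
- by rewrite !big_cat /= addrC.
- by rewrite big_seq1 big_cons big_seq1 biaddl.
- by rewrite big_seq1 big_cons big_seq1 biaddr.
- by rewrite big_seq1 big_nil bi0l.
Qed.

Lemma tlift_subproof : {morph tlift_fun : t u / t + u}.
Proof.
move=> t u; rewrite -[t]zt_repr -[u]zt_repr -[X in tlift_fun X]/(zt_add _ _).
by rewrite zt_addE !tlift_class big_cat.
Qed.
Definition tlift : {additive ztens -> C} := mkadd tlift_subproof.

Lemma tliftE a b : tlift (tpair a b) = f a b.
Proof. by rewrite /= tlift_class big_seq1. Qed.

End Lift.

Lemma ztens_ind (P : ztens -> Prop) :
  P 0 -> (forall a b t, P t -> P (tpair a b + t)) -> forall t, P t.
Proof.
move=> P0 PD t; rewrite -[t]zt_repr; elim: (repr t) => [//|[a b] s IHs].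
by rewrite -cat1s -zt_addE; apply: PD.
Qed.

End ZTensor.

Section TensorComplex.
Variables A B : precomplex.

Definition tens_pr_fun (p : int) (a : A) (b : B) : ztens A B :=
  \sum_(i <- supp a) tpair A B (pr i a) (pr (p - i) b).
Lemma tens_pr_subproofl p b : {morph tens_pr_fun p ^~ b : x y / x + y}.
Proof.
apply: (@sum_supp_add _ _ (fun i x => tpair A B x (pr (p - i) b))) => i x y.
exact: biaddl.
Qed.
Lemma tens_pr_subproofr p a : {morph tens_pr_fun p a : x y / x + y}.
Proof.
move=> x y; rewrite /tens_pr_fun -big_split; apply: eq_bigr => i _.
by rewrite raddfD biaddr.
Qed.
Definition tens_pr p : {additive ztens A B -> ztens A B} :=
  tlift (Biadd (tens_pr_subproofl p) (tens_pr_subproofr p)).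

Lemma tens_prE p a b : tens_pr p (tpair A B a b) = tens_pr_fun p a b.
Proof. exact: tliftE. Qed.

Lemma tens_pr_homog p i j (a : A) (b : B) : homog i a -> homog j b ->
  tens_pr p (tpair A B a b) = if i + j == p then tpair A B a b else 0.
Proof.
move=> ha hb; rewrite tens_prE /tens_pr_fun.
have pa k : pr k a = if k == i then a else 0.
  by rewrite -ha pr_pr; case: eqP => // ->.
have pb k : pr k b = if k == j then b else 0.
  by rewrite -hb pr_pr; case: eqP => // ->.
rewrite (@sum_supp _ _ (fun k x => tpair A B x (pr (p - k) b)) _
  (undup (i :: supp a))) ?undup_uniq //; last 2 first.
- by move=> k; rewrite bi0l.
- by move=> k ka; rewrite mem_undup inE ka orbT.
rewrite (bigD1_seq i) ?undup_uniq ?mem_undup ?mem_head // pa eqxx.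
rewrite big1; last by move=> k /negPf ki; rewrite pa ki bi0l.
rewrite [LHS]addr0 pb subr_eq addrC [p == _]eq_sym.
by case: ifP; rewrite ?bi0r.
Qed.

Lemma tens_pr_pr p q t :
  tens_pr p (tens_pr q t) = if p == q then tens_pr p t else 0.
Proof.
elim/ztens_ind: t => [|a b t IHt]; first by rewrite !raddf0 if_same.
rewrite !raddfD IHt tens_prE /tens_pr_fun raddf_sum.
have -> : \sum_(i <- supp a) tens_pr p (tpair A B (pr i a) (pr (q - i) b)) =
  \sum_(i <- supp a) (if p == q then tpair A B (pr i a) (pr (q - i) b) else 0).
  apply: eq_bigr => i _; rewrite (@tens_pr_homog _ i (q - i)).
  - by rewrite addrC subrK eq_sym.
  - by rewrite /homog pr_pr eqxx.
  - by rewrite /homog pr_pr eqxx.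
case: eqP => [->|_]; last by rewrite big1 ?addr0.
by rewrite tens_prE.
Qed.

Lemma tens_pr_sum t :
  exists2 s : seq int, uniq s & t = \sum_(p <- s) tens_pr p t.
Proof.
suff [s sP] : exists s : seq int, forall s', uniq s' -> {subset s <= s'} ->
    t = \sum_(p <- s') tens_pr p t.
  exists (undup s); first exact: undup_uniq.
  by apply: sP; rewrite ?undup_uniq // => p; rewrite mem_undup.
elim/ztens_ind: t => [|a b t [s sP]].
  by exists [::] => s' _ _; rewrite big1 // => p _; rewrite raddf0.
exists (s ++ [seq i + j | i <- supp a, j <- supp b]) => s' us' ss'.
under eq_bigr do rewrite raddfD; rewrite big_split -sP //; last first.
  by move=> p ps; apply: ss'; rewrite mem_cat ps.
congr (_ + t).
have -> : tpair A B a b =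
    \sum_(i <- supp a) \sum_(j <- supp b) tpair A B (pr i a) (pr j b).
  rewrite [in LHS](suppE a) bi_suml; apply: eq_bigr => i _.
  by rewrite [in LHS](suppE b) bi_sumr.
under [RHS]eq_bigr do rewrite raddf_sum.
rewrite [RHS]exchange_big; apply: eq_big_seq => i ia.
under [RHS]eq_bigr do rewrite raddf_sum.
rewrite [RHS]exchange_big; apply: eq_big_seq => j jb.
have ijs : i + j \in s'.
  by apply: ss'; rewrite mem_cat; apply/orP; right; apply/allpairsP; exists (i, j).
have h p : tens_pr p (tpair A B (pr i a) (pr j b)) =
  if i + j == p then tpair A B (pr i a) (pr j b) else 0.
  by apply: tens_pr_homog; rewrite /homog pr_pr eqxx.
under [RHS]eq_bigr do rewrite h.
rewrite (bigD1_seq _ ijs us') eqxx big1 ?[RHS]addr0 // => p /negPf.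
by rewrite eq_sym => ->.
Qed.

Definition tens_df_fun (a : A) (b : B) : ztens A B :=
  tpair A B (df a) b + tpair A B (eps A a) (df b).
Lemma tens_df_subproofl b : {morph tens_df_fun ^~ b : x y / x + y}.
Proof. by move=> x y; rewrite /tens_df_fun !raddfD !biaddl addrACA. Qed.
Lemma tens_df_subproofr a : {morph tens_df_fun a : x y / x + y}.
Proof. by move=> x y; rewrite /tens_df_fun !raddfD !biaddr addrACA. Qed.
Definition tens_df : {additive ztens A B -> ztens A B} :=
  tlift (Biadd tens_df_subproofl tens_df_subproofr).

Definition tensor : precomplex := Precomplex tens_pr_pr tens_pr_sum tens_df.

End TensorComplex.

Definition tmap (A B A' B' : zmodType)
    (f : {additive A -> A'}) (g : {additive B -> B'}) :
    {additive ztens A B -> ztens A' B'} :=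
  tlift (bi_pre f g (tpair A' B')).

(* Tensor powers; C^{(x) 0} is Z in degree 0. *)
Definition tpow (C : precomplex) (n : nat) : precomplex :=
  iter n (tensor C) (deg0 int).

Fixpoint tpow_map (C D : precomplex) (f : {additive C -> D}) n :
    {additive tpow C n -> tpow D n} :=
  if n is n'.+1 then tmap f (tpow_map f n') else idfun.

(** ** Direct sums over the natural numbers *)

Section DirectSum.
Variable V : nat -> zmodType.

Record dsum := DSum {
  dsum_fun :> forall n, V n;
  dsum_fin : exists N, forall n, (N <= n)%N -> dsum_fun n = 0 }.
HB.instance Definition _ := gen_eqMixin dsum.
HB.instance Definition _ := gen_choiceMixin dsum.

Lemma dsumP (x y : dsum) : (forall n, x n = y n) -> x = y.
Proof.
case: x y => [x xP] [y yP] /= xy.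
have e : x = y by apply: functional_extensionality_dep.
by case: y / e yP {xy} => yP; congr DSum; apply: Prop_irrelevance.
Qed.

Lemma dsum_zero_subproof : exists N, forall n, (N <= n)%N -> (0 : V n) = 0.
Proof. by exists 0. Qed.
Definition dsum_zero := DSum dsum_zero_subproof.
Lemma dsum_opp_subproof (x : dsum) :
  exists N, forall n, (N <= n)%N -> - x n = 0.
Proof. by have [N xN] := dsum_fin x; exists N => n /xN ->; rewrite oppr0. Qed.
Definition dsum_opp x := DSum (dsum_opp_subproof x).
Lemma dsum_add_subproof (x y : dsum) :
  exists N, forall n, (N <= n)%N -> x n + y n = 0.
Proof.
have [[N xN] [M yM]] := (dsum_fin x, dsum_fin y); exists (maxn N M) => n.
by rewrite geq_max => /andP[/xN -> /yM ->]; rewrite addr0.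
Qed.
Definition dsum_add x y := DSum (dsum_add_subproof x y).
Lemma dsum_addA : associative dsum_add.
Proof. by move=> x y z; apply: dsumP => n; apply: addrA. Qed.
Lemma dsum_addC : commutative dsum_add.
Proof. by move=> x y; apply: dsumP => n; apply: addrC. Qed.
Lemma dsum_add0 : left_id dsum_zero dsum_add.
Proof. by move=> x; apply: dsumP => n; apply: add0r. Qed.
Lemma dsum_addN : left_inverse dsum_zero dsum_opp dsum_add.
Proof. by move=> x; apply: dsumP => n; apply: addNr. Qed.
HB.instance Definition _ :=
  GRing.isZmodule.Build dsum dsum_addA dsum_addC dsum_add0 dsum_addN.

Lemma dsumD (x y : dsum) n : (x + y) n = x n + y n. Proof. by []. Qed.

Lemma dsum_sum_app (I : Type) (s : seq I) (P : pred I) (F : I -> dsum) n :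
  (\sum_(i <- s | P i) F i) n = \sum_(i <- s | P i) F i n.
Proof. by apply: (big_morph (fun x : dsum => x n) (fun x y => dsumD x y n)). Qed.

Definition dbound (x : dsum) : nat := sval (cid (dsum_fin x)).
Lemma dboundP (x : dsum) n : (dbound x <= n)%N -> x n = 0.
Proof. exact: svalP (cid (dsum_fin x)) n. Qed.

Lemma dsum_sumE (W : zmodType) (P : pred nat) (F : forall n, V n -> W)
    (x : dsum) N :
    (forall n, F n 0 = 0) -> (forall n, (N <= n)%N -> x n = 0) ->
  \sum_(n < dbound x | P n) F n (x n) = \sum_(n < N | P n) F n (x n).
Proof.
move=> F0 xN; pose M := maxn N (dbound x).
have sumM K : (K <= M)%N -> (forall n, (K <= n)%N -> x n = 0) ->
    \sum_(n < K | P n) F n (x n) = \sum_(n < M | P n) F n (x n).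
  move=> KM xK; rewrite (big_ord_widen_cond _ P (fun n => F n (x n)) KM).
  rewrite [RHS](bigID (fun n : 'I_M => (n < K)%N)) /= [X in _ = _ + X]big1 ?addr0 //.
  by move=> n /andP[_]; rewrite -leqNgt => /xK ->.
rewrite !sumM ?leq_maxl ?leq_maxr //; exact: dboundP.
Qed.

Lemma dsum_sum_add (W : zmodType) (P : pred nat) (F : forall n, V n -> W) :
  (forall n, {morph F n : x y / x + y}) ->
  {morph (fun x : dsum => \sum_(n < dbound x | P n) F n (x n)) : x y / x + y}.
Proof.
move=> FD x y; have F0 n : F n 0 = 0 := raddf0 (mkadd (FD n)).
pose N := maxn (dbound x) (dbound y).
have [xN yN] : (forall n, (N <= n)%N -> x n = 0) /\
               (forall n, (N <= n)%N -> y n = 0).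
  by split=> n; rewrite geq_max => /andP[? ?]; apply: dboundP.
rewrite !(@dsum_sumE _ _ F _ N) //; last first.
  by move=> n Nn; rewrite dsumD xN ?yN ?addr0.
by rewrite -big_split; apply: eq_bigr => n _; rewrite dsumD FD.
Qed.

End DirectSum.

Section DirectSumMaps.

Lemma dsum_map_subproof (V W : nat -> zmodType)
    (f : forall n, {additive V n -> W n}) (x : dsum V) :
  exists N, forall n, (N <= n)%N -> f n (x n) = 0.
Proof. by have [N xN] := dsum_fin x; exists N => n /xN ->; rewrite raddf0. Qed.
Lemma dsum_map_add (V W : nat -> zmodType) (f : forall n, {additive V n -> W n}) :
  {morph (fun x : dsum V => DSum (dsum_map_subproof f x)) : x y / x + y}.
Proof. by move=> x y; apply: dsumP => n /=; rewrite raddfD. Qed.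
Definition dsum_map (V W : nat -> zmodType) (f : forall n, {additive V n -> W n}) :
  {additive dsum V -> dsum W} := mkadd (dsum_map_add f).

Variables (V W : nat -> zmodType) (A : zmodType).

Lemma dsum_bir_add (f : forall n, biadd A (V n) (W n)) (x : dsum V) :
  {morph (fun a => dsum_map (fun n => bi_r (f n) a) x) : a b / a + b}.
Proof. by move=> a b; apply: dsumP => n /=; rewrite biaddl. Qed.
Definition dsum_bir (f : forall n, biadd A (V n) (W n)) :
    biadd A (dsum V) (dsum W) :=
  @Biadd _ _ _ (fun a => dsum_map (fun n => bi_r (f n) a))
    (dsum_bir_add f) (fun a => raddfD (dsum_map (fun n => bi_r (f n) a))).

Lemma dsum_bil_add (f : forall n, biadd (V n) A (W n)) (x : dsum V) :
  {morph (fun a => dsum_map (fun n => bi_l (f n) a) x) : a b / a + b}.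
Proof. by move=> a b; apply: dsumP => n /=; rewrite biaddr. Qed.
Definition dsum_bil (f : forall n, biadd (V n) A (W n)) :
    biadd (dsum V) A (dsum W) :=
  @Biadd _ _ _ (fun x a => dsum_map (fun n => bi_l (f n) a) x)
    (fun a => raddfD (dsum_map (fun n => bi_l (f n) a))) (dsum_bil_add f).

End DirectSumMaps.

(* The direct sum of the C n, with C n shifted up by n. *)
Section ShiftedSum.
Variable C : nat -> precomplex.

Definition ssum_pr (p : int) : {additive dsum C -> dsum C} :=
  dsum_map (fun n => pr (p - n%:Z)).

Lemma ssum_pr_pr p q x : ssum_pr p (ssum_pr q x) = if p == q then ssum_pr p x else 0.
Proof.
apply: dsumP => n; rewrite /= pr_pr (inj_eq (addIr _)).
by case: eqP.
Qed.

Lemma ssum_pr_sum x : exists2 s : seq int, uniq s & x = \sum_(p <- s) ssum_pr p x.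
Proof.
pose s := undup (flatten [seq [seq p + n%:Z | p <- supp (x n)] | n <- iota 0 (dbound x)]).
exists s; first exact: undup_uniq.
apply: dsumP => n; rewrite dsum_sum_app /=.
have [nx|/dboundP ->] := ltnP n (dbound x); last first.
  by rewrite big1 // => p _; rewrite raddf0.
rewrite -(big_map (fun p => p - n%:Z) xpredT (fun q => pr q (x n))).
rewrite {1}(suppE (x n)).
apply/esym/sum_sub; first exact: supp_uniq.
- by rewrite map_inj_uniq ?undup_uniq //; apply: addIr.
- move=> p px; apply/mapP; exists (p + n%:Z); last by rewrite addrK.
  rewrite mem_undup; apply/flatten_mapP; exists n; first by rewrite mem_iota.
  exact: map_f.
- by move=> p; apply: supp_out.
Qed.

Definition ssum (d : {additive dsum C -> dsum C}) : precomplex :=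
  Precomplex ssum_pr_pr ssum_pr_sum d.

End ShiftedSum.
(** * Monoidal dg-categories and props *)

Record dgcat_data (O : Type) := DgcatData {
  mor : O -> O -> precomplex;
  compm : forall x y z, biadd (mor x y) (mor y z) (mor x z);
  idm : forall x, mor x x }.

Arguments compm {O d x y z} : rename.
Arguments idm {O d} x : rename.

(* The identity morphism along an equality of objects. *)
Definition idcast (O : Type) (E : dgcat_data O) (x y : O) (e : x = y) :
    mor E x y :=
  ecast z (mor E x z) e (idm x).

Record is_dgcat (O : Type) (E : dgcat_data O) : Prop := {
  mor_complex : forall x y : O, is_complex (mor E x y);
  compm_chain : forall x y z : O, bichain (@compm _ E x y z);
  idm_homog : forall x : O, homog 0 (idm x : mor E x x);
  idm_df : forall x : O, df (idm x : mor E x x) = 0;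
  compmA : forall (x y z t : O) (f : mor E x y) (g : mor E y z) (h : mor E z t),
    compm (compm f g) h = compm f (compm g h);
  compm_idl : forall (x y : O) (f : mor E x y), compm (idm x) f = f;
  compm_idr : forall (x y : O) (f : mor E x y), compm f (idm y) = f }.

Record moncat_data (O : Type) (add : O -> O -> O) := MoncatData {
  mon_cat :> dgcat_data O;
  tens : forall x y x' y',
    biadd (mor mon_cat x y) (mor mon_cat x' y')
      (mor mon_cat (add x x') (add y y')) }.

Arguments tens {O add m x y x' y'} : rename.

(* Strict monoidal dg-categories; since associativity and unitality of [add]
   are only propositional equalities, strictness is stated up to [idcast]. *)
Record is_moncat (O : Type) (add : O -> O -> O) (zero : O)
    (E : moncat_data add) : Prop := {
  mon_dgcat : is_dgcat E;
  tens_chain : forall x y x' y' : O, bichain (@tens _ _ E x y x' y');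
  tens_id : forall x y : O, tens (idm x) (idm y) = idm (add x y) :> mor E _ _;
  tens_comp : forall (x y z x' y' z' : O) (p q : int) (f : mor E x y)
      (g : mor E y z) (f' : mor E x' y') (g' : mor E y' z'),
    homog p f' -> homog q g ->
    compm (tens f f') (tens g g') = tens (compm f g) (compm f' g') *~ ksign p q;
  tensA : forall (x y x' y' x'' y'' : O) (f : mor E x y) (f' : mor E x' y')
      (f'' : mor E x'' y'')
      (e : add (add x x') x'' = add x (add x' x''))
      (e' : add (add y y') y'' = add y (add y' y'')),
    compm (tens (tens f f') f'') (idcast E e') =
    compm (idcast E e) (tens f (tens f' f''));
  tens_unitl : forall (x y : O) (f : mor E x y)
      (e : add zero x = x) (e' : add zero y = y),
    compm (tens (idm zero) f) (idcast E e') = compm (idcast E e) f;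
  tens_unitr : forall (x y : O) (f : mor E x y)
      (e : add x zero = x) (e' : add y zero = y),
    compm (tens f (idm zero)) (idcast E e') = compm (idcast E e) f }.

Record prop_data := PropData {
  prop_mon :> moncat_data addn;
  symm : forall m n : nat, mor prop_mon (m + n) (n + m) }.

Arguments symm {p} m n : rename.

Record is_prop (E : prop_data) : Prop := {
  prop_moncat : is_moncat 0%N E;
  symm_homog : forall m n : nat, homog 0 (symm m n : mor E _ _);
  symm_df : forall m n : nat, df (symm m n : mor E _ _) = 0;
  symm_nat : forall (m n m' n' : nat) (p q : int)
      (f : mor E m n) (f' : mor E m' n'), homog p f -> homog q f' ->
    compm (tens f f') (symm n n') = compm (symm m m') (tens f' f) *~ ksign p q;
  symm_inv : forall m n : nat,
    compm (symm m n) (symm n m) = idm (m + n)%N :> mor E _ _;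
  symm_hexagon : forall m n p : nat,
    symm m (n + p) =
    compm (idcast E (addnA m n p))
      (compm (tens (symm m n) (idm p))
        (compm (idcast E (esym (addnA n m p)))
          (compm (tens (idm n) (symm m p)) (idcast E (addnA n p m)))))
    :> mor E _ _ }.

Record prop := Prop_ { prop_pack :> prop_data; prop_axioms : is_prop prop_pack }.

(** * The prop of planar forests *)

(** ** Complexes with a finite basis *)

Section FiniteBasis.
Variables T U K : finType.

Definition ffun_lin_fun (c : T -> K -> int) (x : {ffun T -> int}) :
  {ffun K -> int} := [ffun k => \sum_t c t k * x t].
Lemma ffun_lin_subproof c : {morph ffun_lin_fun c : x y / x + y}.
Proof.
move=> x y; apply/ffunP => k; rewrite !ffunE -big_split.
by apply: eq_bigr => t _; rewrite ffunE mulrDr.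
Qed.
(* The linear map with matrix c. *)
Definition ffun_lin c : {additive {ffun T -> int} -> {ffun K -> int}} :=
  mkadd (ffun_lin_subproof c).

Definition ffun_bi_fun (c : T -> U -> K -> int)
    (x : {ffun T -> int}) (y : {ffun U -> int}) : {ffun K -> int} :=
  [ffun k => \sum_t \sum_u c t u k * (x t * y u)].
Lemma ffun_bi_subproofl c y : {morph ffun_bi_fun c ^~ y : x x' / x + x'}.
Proof.
move=> x x'; apply/ffunP => k; rewrite !ffunE -big_split.
apply: eq_bigr => t _; rewrite -big_split.
by apply: eq_bigr => u _; rewrite ffunE mulrDl mulrDr.
Qed.
Lemma ffun_bi_subproofr c x : {morph ffun_bi_fun c x : y y' / y + y'}.
Proof.
move=> y y'; apply/ffunP => k; rewrite !ffunE -big_split.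
apply: eq_bigr => t _; rewrite -big_split.
by apply: eq_bigr => u _; rewrite ffunE !mulrDr.
Qed.
(* The biadditive map with structure constants c. *)
Definition ffun_bi c :
    biadd {ffun T -> int} {ffun U -> int} {ffun K -> int} :=
  Biadd (ffun_bi_subproofl c) (ffun_bi_subproofr c).

Variable deg : T -> int.

Definition ffun_pr_fun (p : int) (x : {ffun T -> int}) : {ffun T -> int} :=
  [ffun t => if deg t == p then x t else 0].
Lemma ffun_pr_subproof p : {morph ffun_pr_fun p : x y / x + y}.
Proof.
by move=> x y; apply/ffunP => t; rewrite !ffunE; case: eqP; rewrite ?addr0.
Qed.
Definition ffun_pr p : {additive {ffun T -> int} -> {ffun T -> int}} :=
  mkadd (@ffun_pr_subproof p).

Lemma ffun_pr_pr p q x : ffun_pr p (ffun_pr q x) = if p == q then ffun_pr p x else 0.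
Proof.
apply/ffunP => t; rewrite !ffunE; case: (eqVneq p q) => [->|pq].
  by rewrite ffunE; case: eqP.
by rewrite ffunE; case: eqP => // ->; rewrite (negPf pq).
Qed.

Lemma ffun_pr_sum x : exists2 s : seq int, uniq s & x = \sum_(p <- s) ffun_pr p x.
Proof.
exists (undup [seq deg t | t <- enum T]); first exact: undup_uniq.
apply/ffunP => t; rewrite sum_ffunE.
rewrite (bigD1_seq (deg t)) ?undup_uniq //=; last first.
  by rewrite mem_undup map_f ?mem_enum.
rewrite ffunE eqxx big1 ?addr0 // => p.
by rewrite ffunE eq_sym => /negPf ->.
Qed.

Definition ffun_complex (d : {additive {ffun T -> int} -> {ffun T -> int}}) :
  precomplex := Precomplex ffun_pr_pr ffun_pr_sum d.

End FiniteBasis.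

(** ** Planar forests *)

(* An isomorphism class of planar forests with leaves 'I_m and roots 'I_n is
   given by
   - the root of the tree containing each leaf;
   - the pairs of leaves (a, b) of the same tree with a to the left of b;
   - for each vertex, the set of leaves above it.
   All vertices having valence at least 3, vertices correspond bijectively to
   sets of at least two leaves of a tree, consecutive for the planar order and
   pairwise nested or disjoint; the root vertex of a tree with at least two
   leaves is the set of all its leaves. *)
Definition raw_forest (m n : nat) : finType :=
  ({ffun 'I_m -> 'I_n} * {set 'I_m * 'I_m} * {set {set 'I_m}})%type.

Section Forest.
Variables m n : nat.
Implicit Types (F : raw_forest m n) (a b c : 'I_m) (B K : {set 'I_m}).

Definition froot F : 'I_m -> 'I_n := F.1.1.
Definition fleft F a b : bool := (a, b) \in F.1.2.
Definition fvert F : {set {set 'I_m}} := F.2.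
Definition fabove F (T : {set 'I_n}) : {set 'I_m} := [set a | froot F a \in T].
Definition ftree F (t : 'I_n) : {set 'I_m} := fabove F [set t].

Definition fleft_ok F : bool :=
  [&& [forall a, forall b, fleft F a b ==> (froot F a == froot F b)],
      [forall a, ~~ fleft F a a],
      [forall a, forall b, forall c, fleft F a b && fleft F b c ==> fleft F a c] &
      [forall a, forall b, (froot F a == froot F b) && (a != b) ==>
        fleft F a b || fleft F b a]].

Definition fvert_ok F B : bool :=
  [&& (1 < #|B|)%N,
      [exists t, B \subset ftree F t],
      [forall a in B, forall c in B, forall b,
        fleft F a b && fleft F b c ==> (b \in B)] &
      [forall B' in fvert F, [|| B \subset B', B' \subset B | [disjoint B & B']]]].

Definition forest_ok F : bool :=
  [&& [forall t, ftree F t != set0], fleft_ok F,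
      [forall B in fvert F, fvert_ok F B] &
      [forall t, (1 < #|ftree F t|)%N ==> (ftree F t \in fvert F)]].

Definition forest : finType := {F : raw_forest m n | forest_ok F}.

(* The half-edges ending, from above, at a vertex: those starting at a vertex
   which is not the root of its tree and those of the leaves of trees with at
   least one vertex.  Both are named after the set of leaves above them. *)
Definition fin F : {set {set 'I_m}} :=
  [set K | ((K \in fvert F) || (#|K| == 1%N)) &&
           [exists B in fvert F, K \proper B]].

(* The half-edges arriving from above at the vertex B. *)
Definition fchildren F B : {set {set 'I_m}} :=
  [set K in fin F | (K \proper B) &&
     ~~ [exists B' in fvert F, (K \proper B') && (B' \proper B)]].

Definition valence F B : nat := #|fchildren F B|.+1.

Definition fdeg F : int := \sum_(B in fvert F) ((valence F B)%:Z - 3).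

(* The internal edges, named after their upper vertex. *)
Definition fedges F : {set {set 'I_m}} := fvert F :&: fin F.

Definition collapse F B : raw_forest m n := (F.1, fvert F :\ B).

End Forest.

(** ** Orientations *)

(* The vertices and half-edges of a forest: [Vx B] is the vertex B, [Out B] the
   half-edge below B attached to B, and [In K] the half-edge below the set of
   leaves K attached to the vertex underneath. *)
Definition cell (m : nat) : finType :=
  ({set 'I_m} + {set 'I_m} + {set 'I_m})%type.
Definition Vx (m : nat) (B : {set 'I_m}) : cell m := inl (inl B).
Definition Out (m : nat) (B : {set 'I_m}) : cell m := inl (inr B).
Definition In (m : nat) (K : {set 'I_m}) : cell m := inr K.

Definition cell_map (m n : nat) (f : {set 'I_m} -> {set 'I_n}) (c : cell m) :
    cell n :=
  match c with
  | inl (inl B) => Vx (f B)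
  | inl (inr B) => Out (f B)
  | inr K => In (f K)
  end.

(* The number of inversions of a sequence. *)
Fixpoint ninv (s : seq nat) : nat :=
  if s is a :: s' then (count (fun b => (b < a)%N) s' + ninv s')%N else 0%N.

(* For two enumerations s and t of the same set, the sign e such that
   s_1 /\ ... /\ s_k = e * (t_1 /\ ... /\ t_k). *)
Definition osign (T : eqType) (s t : seq T) : int :=
  (-1) ^+ ninv [seq index x t | x <- s].

(* The basis element indexed by a forest F is F with the orientation given by
   the wedge product of the following enumeration of its cells. *)
Definition forient (m n : nat) (F : raw_forest m n) : seq (cell m) :=
  enum ([set Vx B | B in fvert F] :|: [set Out B | B in fvert F] :|:
        [set In K | K in fin F]).

(** ** The prop *)

Section Ainfinity.

(* The coefficient of G in the differential of F.  Let B be an edge of G with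
   lower vertex v1 and upper vertex v2 = Vx B.  The orientation
     v1 /\ Vx B /\ In B /\ Out B /\ x = - Vx B /\ In B /\ Out B /\ v1 /\ x
   of G collapses to v /\ x; as the vertex v of the collapse has the same name
   as v1, the orientation o of F comes from - Vx B /\ In B /\ Out B /\ o. *)
Definition blowup_coef m n (F G : forest m n) : int :=
  \sum_(B in fedges (val G) | collapse (val G) B == val F)
    - osign ([:: Vx B; In B; Out B] ++ forient (val F)) (forient (val G)).

Definition forest_complex (m n : nat) : precomplex :=
  ffun_complex (fun F : forest m n => fdeg (val F)) (ffun_lin (@blowup_coef m n)).

(* The root t of F is grafted to the leaf t of G: the leaves above a cell of G
   become the leaves of the trees of F grafted to them. *)
Definition graft m n p (F : raw_forest m n) (G : raw_forest n p) :
    raw_forest m p :=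
  ([ffun a => froot G (froot F a)],
   [set ab | fleft F ab.1 ab.2 || fleft G (froot F ab.1) (froot F ab.2)],
   fvert F :|: [set fabove F B | B in fvert G]).

Definition graft_coef m n p
    (F : forest m n) (G : forest n p) (H : forest m p) : int :=
  if val H == graft (val F) (val G) then
    osign (forient (val F) ++
           map (cell_map (fabove (val F))) (forient (val G)))
          (forient (val H))
  else 0.

Definition join m n m' n' (F : raw_forest m n) (G : raw_forest m' n') :
    raw_forest (m + m') (n + n') :=
  ([ffun a => match split a with
              | inl b => lshift n' (froot F b)
              | inr b => rshift n (froot G b)
              end],
   [set (lshift m' ab.1, lshift m' ab.2) | ab in F.1.2] :|:
   [set (rshift m ab.1, rshift m ab.2) | ab in G.1.2],
   [set [set lshift m' a | a in B] | B : {set 'I_m} in fvert F] :|: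
   [set [set rshift m a | a in B] | B : {set 'I_m'} in fvert G]).

Definition join_coef m n m' n' (F : forest m n) (G : forest m' n')
    (H : forest (m + m') (n + n')) : int :=
  if val H == join (val F) (val G) then
    osign
      (map (cell_map (fun B : {set 'I_m} => [set lshift m' a | a in B]))
         (forient (val F)) ++
       map (cell_map (fun B : {set 'I_m'} => [set rshift m a | a in B]))
         (forient (val G)))
      (forient (val H))
  else 0.

(* The forest without vertices with root map r (bijective). *)
Definition bare m n (r : 'I_m -> 'I_n) : forest_complex m n :=
  [ffun F : forest m n => (val F == (finfun r, set0, set0))%:R].

Definition Ainf_cat : dgcat_data nat :=
  @DgcatData nat forest_complex
    (fun m n p => ffun_bi (@graft_coef m n p)) (fun m => bare id).

Definition Ainf_mon : moncat_data addn :=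
  @MoncatData nat addn Ainf_cat (fun m n m' n' => ffun_bi (@join_coef m n m' n')).

Definition Ainf : prop_data :=
  @PropData Ainf_mon (fun m n => bare (fun a : 'I_(m + n) =>
    match split a with inl b => rshift n b | inr b => lshift m b end)).

End Ainfinity.

Record ainf_mult (E : prop) := AinfMult {
  ainf_map :> forall m n : nat, chain_map (mor Ainf m n) (mor E m n);
  ainf_id : forall m : nat, ainf_map m m (idm m) = idm m;
  ainf_comp : forall (m n p : nat) (f : mor Ainf m n) (g : mor Ainf n p),
    ainf_map m p (compm f g) = compm (ainf_map m n f) (ainf_map n p g);
  ainf_tens : forall (m n m' n' : nat) (f : mor Ainf m n) (g : mor Ainf m' n'),
    ainf_map (m + m')%N (n + n')%N (tens f g) =
    tens (ainf_map m n f) (ainf_map m' n' g);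
  ainf_symm : forall m n : nat,
    ainf_map (m + n)%N (n + m)%N (symm m n) = symm m n }.

(** * The Hochschild complex *)

(** ** The differential of l_n *)

(* The blow-up of l_n moving the r = n + 1 - k leaves h_j, ..., h_(j+r-1)
   (indices start at 0, modulo n) to a new vertex, cut around the white
   vertex. *)
Section Blowup.
Variables n k j : nat.
Implicit Type a : 'I_n.

(* The number of moved leaves, and the position of a counted from h_j. *)
Definition nmoved : nat := (n.+1 - k)%N.
Definition cpos a : nat := ((a + n - j) %% n)%N.

Definition moved : {set 'I_n} := [set a | (cpos a < nmoved)%N].

(* The position around the white vertex, counted from the start half-edge, of
   the half-edge below the leaf a.  If j + r > n then h_0 is moved, the new edge
   becomes the start half-edge and it is followed by h_(j+r-n), ..., h_(j-1);
   this also covers j = 0 through the first case. *)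
Definition wpos a : nat :=
  if (j + nmoved <= n)%N then
    if a \in moved then j
    else if (a < j)%N then a : nat else (a - nmoved.-1)%N
  else if a \in moved then 0%N else (a - (j + nmoved - n)).+1.

Definition is_blowup (F : raw_forest n k) : bool :=
  [&& [forall a, froot F a == wpos a :> nat],
      [forall a, forall b, fleft F a b ==
        [&& a \in moved, b \in moved & (cpos a < cpos b)%N]] &
      fvert F == [set moved]].

(* The sign with which F occurs: the orientation of F followed by the one of
   l_k, where [None] is the white vertex, is compared with the orientation
     w /\ Vx B /\ In B /\ Out B /\ h_1 /\ ... /\ h_n
   which collapses to w /\ h_1 /\ ... /\ h_n. *)
Definition blowup_sign (F : raw_forest n k) : int :=
  osign
    (map Some (forient F) ++
     None :: [seq Some (In (ftree F t)) | t <- enum 'I_k])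
    (None :: map Some [:: Vx moved; In moved; Out moved] ++
     [seq Some (In [set a]) | a <- enum 'I_n]).

End Blowup.

(* The element f_(n,k) of A_oo(n, k), for 0 < k < n. *)
Definition fL (n k : nat) : mor Ainf n k :=
  [ffun F : forest n k =>
    \sum_(j < n | is_blowup j (val F)) blowup_sign j (val F)].

(** ** Functors to complexes *)

Record functor_data (E : dgcat_data nat) := FunctorData {
  fob :> nat -> precomplex;
  fact : forall m n : nat, biadd (fob m) (mor E m n) (fob n) }.

Arguments fact {E f m n} : rename.

Record is_functor (E : dgcat_data nat) (Phi : functor_data E) : Prop := {
  fob_complex : forall n : nat, is_complex (Phi n);
  fact_chain : forall m n : nat, bichain (@fact _ Phi m n);
  fact_id : forall (m : nat) (x : Phi m), fact x (idm m) = x;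
  fact_comp : forall (m n p : nat) (x : Phi m) (f : mor E m n) (g : mor E n p),
    fact x (compm f g) = fact (fact x f) g }.

(* The functor E(m, -). *)
Definition corep (E : dgcat_data nat) (m : nat) : functor_data E :=
  @FunctorData E (mor E m) (fun n p => @compm _ E m n p).

Section Hochschild.
Variables (E : prop) (i : ainf_mult E).

Section OneStep.
Variable Phi : functor_data E.

(* The component k of C(Phi)(m) is Phi(k + 1 + m) (x) L_(k + 1). *)
Definition hoch_obj_sum (m : nat) : zmodType := dsum (fun k => Phi (k.+1 + m)%N).

Definition hoch_df_fun m (x : hoch_obj_sum m) (k : nat) : Phi (k.+1 + m)%N :=
  df (x k) +
  \sum_(n < dbound x | (k < n)%N)
    fact (eps _ (x n)) (tens (i n.+1 k.+1 (fL n.+1 k.+1)) (idm m)).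

Lemma hoch_df_fin m (x : hoch_obj_sum m) :
  exists N, forall k, (N <= k)%N -> hoch_df_fun x k = 0.
Proof.
exists (dbound x) => k xk; rewrite /hoch_df_fun dboundP // raddf0 add0r.
by rewrite big1 // => n kn; have := leq_trans (ltn_ord n) xk; rewrite ltnNge ltnW.
Qed.

Lemma hoch_df_add m :
  {morph (fun x : hoch_obj_sum m => DSum (hoch_df_fin x)
     : hoch_obj_sum m) : x y / x + y}.
Proof.
move=> x y; apply: dsumP => k; rewrite /= /hoch_df_fun.
rewrite (@dsum_sum_add _ _ (fun n => k < n)%N (fun n z =>
  fact (eps _ z) (tens (i n.+1 k.+1 (fL n.+1 k.+1)) (idm m)))).
  by rewrite raddfD addrACA.
by move=> n u v; rewrite raddfD biaddl.
Qed.

Definition hoch_ob (m : nat) : precomplex := ssum (mkadd (@hoch_df_add m)).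

Definition hoch_act (m n : nat) : biadd (hoch_ob m) (mor E m n) (hoch_ob n) :=
  dsum_bil (fun k => bi_pre idfun (epsn _ k)
    (bi_pre idfun (bi_r tens (idm k.+1)) (@fact _ Phi (k.+1 + m) (k.+1 + n)))).

Definition hoch : functor_data E := FunctorData hoch_act.

End OneStep.

(* Iteration: the outermost direct sum of [ihoch n Phi] is the one of the last
   factor L_(k_n) of the n-fold iterate. *)
Definition ihoch (n : nat) (Phi : functor_data E) : functor_data E :=
  iter n hoch Phi.

Definition hoch_map (Phi Psi : functor_data E)
    (theta : forall n, {additive Phi n -> Psi n}) (m : nat) :
    {additive hoch Phi m -> hoch Psi m} :=
  dsum_map (fun k => theta (k.+1 + m)%N).

(** ** The core category *)

(* The functoriality of C^n(E(m, -)) in m. *)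
Fixpoint precomp (n m1 m2 m3 : nat) :
    biadd (mor E m1 m2) (ihoch n (corep E m2) m3) (ihoch n (corep E m1) m3) :=
  match n with
  | 0 => compm
  | n'.+1 => dsum_bir (fun k => precomp n' m1 m2 (k.+1 + m3))
  end.

(* The external product
     C^n(Phi)(m) (x) C^n'(Psi)(m') -> C^(n + n')(Theta)(m + m')
   extending a product Phi(a) (x) Psi(b) -> Theta(a + b). *)
Section ExternalProduct.
Variables Phi Psi Theta : functor_data E.
Variable mu : forall a b : nat, biadd (Phi a) (Psi b) (Theta (a + b)%N).

(* (x (x) l_K (x) l_(k+1)) . y = (-1)^(k|y|) ((x (x) l_K) . y) (x) l_(k+1) *)
Fixpoint ext_prodl (n m m' : nat) :
    biadd (ihoch n Phi m) (Psi m') (ihoch n Theta (m + m')%N) :=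
  match n with
  | 0 => mu m m'
  | n'.+1 => dsum_bil (fun k =>
      bi_post (bi_l fact (idcast E (esym (addnA k.+1 m m'))))
        (bi_pre idfun (epsn _ k) (ext_prodl n' (k.+1 + m) m')))
  end.

(* x . (y (x) l_K' (x) l_(k+1)) = (x . (y (x) l_K')) (x) l_(k+1), up to the
   symmetry m + (k + 1 + m') -> k + 1 + (m + m'). *)
Fixpoint ext_prod (n n' m m' : nat) :
    biadd (ihoch n Phi m) (ihoch n' Psi m') (ihoch (n' + n) Theta (m + m')%N) :=
  match n' with
  | 0 => ext_prodl n m m'
  | n''.+1 => dsum_bir (fun k =>
      bi_post (bi_l fact
          (compm (idcast E (addnA m k.+1 m'))
            (compm (tens (symm m k.+1) (idm m'))
              (idcast E (esym (addnA k.+1 m m'))))))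
        (ext_prod n n'' m (k.+1 + m')))
  end.

End ExternalProduct.

End Hochschild.

(* Z if x = y, and 0 otherwise: the integer functions on the proofs of x = y. *)
Section IdentityComplex.
Variables (O : Type) (x y : O).

Definition idgroup : Type := x = y -> int.
HB.instance Definition _ := gen_eqMixin idgroup.
HB.instance Definition _ := gen_choiceMixin idgroup.
Lemma idgroup_addA : associative (fun f g : idgroup => (fun e => f e + g e) : idgroup).
Proof. by move=> f g h; apply/funext => e; apply: addrA. Qed.
Lemma idgroup_addC : commutative (fun f g : idgroup => (fun e => f e + g e) : idgroup).
Proof. by move=> f g; apply/funext => e; apply: addrC. Qed.
Lemma idgroup_add0 :
  left_id ((fun=> 0) : idgroup) (fun f g : idgroup => (fun e => f e + g e) : idgroup).
Proof. by move=> f; apply/funext => e; apply: add0r. Qed.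
Lemma idgroup_addN :
  left_inverse ((fun=> 0) : idgroup) (fun f : idgroup => (fun e => - f e) : idgroup)
    (fun f g : idgroup => (fun e => f e + g e) : idgroup).
Proof. by move=> f; apply/funext => e; apply: addNr. Qed.
HB.instance Definition _ := GRing.isZmodule.Build idgroup
  idgroup_addA idgroup_addC idgroup_add0 idgroup_addN.

Definition idcomplex : precomplex := deg0 idgroup.

(* Composition with a multiple of an identity. *)
Variable H : O -> precomplex.

Definition idscale_fun (f : idgroup) (u : H x) : H y :=
  match pselect (x = y) with
  | left e => ecast z (H z) e u *~ f e
  | right _ => 0
  end.
Lemma idscale_subproofl u : {morph idscale_fun^~ u : f g / f + g}.
Proof.
move=> f g; rewrite /idscale_fun; case: pselect => [e|_]; last by rewrite addr0.
exact: mulrzDr.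
Qed.
Lemma idscale_subproofr f : {morph idscale_fun f : u v / u + v}.
Proof.
move=> u v; rewrite /idscale_fun; case: pselect => [e|_]; last by rewrite addr0.
by rewrite -mulrzDl; move: (f e) => k; case: y / e.
Qed.
Definition idscale : biadd idgroup (H x) (H y) :=
  Biadd idscale_subproofl idscale_subproofr.

End IdentityComplex.
Section IdentityScaling.
Variables (O : Type) (x y : O) (H : O -> precomplex).

Definition idscaler : biadd (H x) (idcomplex x y) (H y) := bi_flip (idscale x y H).

Lemma idsym_subproof :
  {morph (fun f : idcomplex x y => (fun e => f (esym e)) : idcomplex y x) :
    f g / f + g}.
Proof. by []. Qed.

Definition idscalel : biadd (idcomplex x y) (H y) (H x) :=
  bi_pre (mkadd idsym_subproof) idfun (idscale y x H).

End IdentityScaling.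

(* [m; n] is the pair (m, n). *)
Definition addp (x y : nat * nat) : nat * nat := (x.1 + y.1, x.2 + y.2)%N.

Section Core.
Variables (E : prop) (i : ainf_mult E).

Definition core_hom (x y : nat * nat) : precomplex :=
  match x.2 with
  | 0 => ihoch i y.2 (corep E x.1) y.1
  | _.+1 => idcomplex x y
  end.

Definition core_comp (x y z : nat * nat) :
    biadd (core_hom x y) (core_hom y z) (core_hom x z) :=
  match x as x return biadd (core_hom x y) (core_hom y z) (core_hom x z) with
  | (m1, 0) =>
    match y as y
      return biadd (core_hom (m1, 0%N) y) (core_hom y z) (core_hom (m1, 0%N) z)
    with
    | (m2, 0) => precomp i z.2 m1 m2 z.1
    | (m2, n2.+1) => idscaler (m2, n2.+1) z (core_hom (m1, 0%N))
    end
  | (m1, n1.+1) => idscalel (m1, n1.+1) y (fun x => core_hom x z)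
  end.

Definition core_id (x : nat * nat) : core_hom x x :=
  match x as x return core_hom x x with
  | (m, 0) => idm m
  | (m, n.+1) => fun=> 1
  end.

Definition core : dgcat_data (nat * nat) := DgcatData core_comp core_id.

(* The monoidal structure on morphisms with sources [m1; 0] and [m1'; 0]. *)
Definition core_tens (m1 m1' : nat) (y y' : nat * nat)
    (f : core_hom (m1, 0%N) y) (g : core_hom (m1', 0%N) y') :
    core_hom (m1 + m1', 0)%N (addp y y') :=
  ecast n (ihoch i n (corep E (m1 + m1')) (y.1 + y'.1)%N) (addnC y'.2 y.2)
    (ext_prod (Phi := corep E m1) (Psi := corep E m1')
       (Theta := corep E (m1 + m1')) i
       (fun a b => @tens _ _ E m1 a m1' b) y.2 y'.2 y.1 y'.1 f g).

(* Extensions of the core category.  In the core category itself the product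
   of morphisms is only given for sources [m1; 0] and [m1'; 0], the other
   morphisms being multiples of identities. *)
Record extension := Extension {
  ext_cat :> moncat_data addp;
  ext_moncat : is_moncat (0, 0)%N ext_cat;
  ext_incl : forall x y : nat * nat, chain_map (mor core x y) (mor ext_cat x y);
  ext_id : forall x : nat * nat, ext_incl x x (idm x) = idm x;
  ext_comp : forall (x y z : nat * nat) (f : mor core x y) (g : mor core y z),
    ext_incl x z (compm f g) = compm (ext_incl x y f) (ext_incl y z g);
  ext_tens : forall (m1 m1' : nat) (y y' : nat * nat)
      (f : mor core (m1, 0%N) y) (g : mor core (m1', 0%N) y'),
    ext_incl (m1 + m1', 0)%N (addp y y') (core_tens f g) =
    tens (ext_incl (m1, 0%N) y f) (ext_incl (m1', 0%N) y' g);
  ext_inj : forall x y : nat * nat, injective (ext_incl x y);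
  ext_surj : forall (m1 : nat) (y : nat * nat) (g : mor ext_cat (m1, 0%N) y),
    exists f : mor core (m1, 0%N) y, ext_incl (m1, 0%N) y f = g }.

End Core.

(** * Algebras and their Hochschild complexes *)

(* Split symmetric monoidal functors to complexes. *)
Record algebra (E : prop) := Algebra {
  alg_fun :> functor_data E;
  alg_functor : is_functor alg_fun;
  alg_mu : forall m n : nat,
    biadd (alg_fun m) (alg_fun n) (alg_fun (m + n)%N);
  alg_one : alg_fun 0%N;
  alg_mu_chain : forall m n : nat, bichain (alg_mu m n);
  alg_one_homog : homog 0 alg_one;
  alg_one_df : df alg_one = 0;
  alg_mu_nat : forall (m n m' n' : nat) (p q : int) (x : alg_fun m)
      (y : alg_fun m') (f : mor E m n) (g : mor E m' n'),
    homog p y -> homog q f ->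
    fact (alg_mu m m' x y) (tens f g) =
    alg_mu n n' (fact x f) (fact y g) *~ ksign p q;
  alg_muA : forall (m n p : nat) (x : alg_fun m) (y : alg_fun n) (z : alg_fun p),
    fact (alg_mu m (n + p)%N x (alg_mu n p y z)) (idcast E (addnA m n p)) =
    alg_mu (m + n)%N p (alg_mu m n x y) z;
  alg_mu1l : forall (m : nat) (x : alg_fun m), alg_mu 0%N m alg_one x = x;
  alg_mu1r : forall (m : nat) (x : alg_fun m),
    fact (alg_mu m 0%N x alg_one) (idcast E (addn0 m)) = x;
  alg_mu_symm : forall (m n : nat) (p q : int) (x : alg_fun m) (y : alg_fun n),
    homog p x -> homog q y ->
    fact (alg_mu m n x y) (symm m n) = alg_mu n m y x *~ ksign p q;
  alg_split : forall m n : nat, bijective (tlift (alg_mu m n));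
  alg_split1 : bijective (fun k : int => alg_one *~ k) }.

(* Morphisms of algebras: monoidal natural transformations. *)
Record alg_hom (E : prop) (A B : algebra E) := AlgHom {
  alg_map :> forall n : nat, chain_map (A n) (B n);
  alg_map_nat : forall (m n : nat) (x : A m) (f : mor E m n),
    alg_map n (fact x f) = fact (alg_map m x) f;
  alg_map_mu : forall (m n : nat) (x : A m) (y : A n),
    alg_map (m + n)%N (alg_mu A m n x y) =
    alg_mu B m n (alg_map m x) (alg_map n y);
  alg_map_one : alg_map 0%N (alg_one A) = alg_one B }.

Section Action.
Variables (E : prop) (i : ainf_mult E).

(* C(A, A)^{(x) n} (x) A^{(x) m} for x = [m; n]. *)
Definition HH (A : algebra E) (x : nat * nat) : precomplex :=
  tensor (tpow (hoch i A 0%N) x.2) (tpow (A 1%N) x.1).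

Definition HH_map (A B : algebra E) (theta : alg_hom A B) (x : nat * nat) :
    {additive HH A x -> HH B x} :=
  tmap (tpow_map (hoch_map i (fun n => theta n) 0%N) x.2)
       (tpow_map (theta 1%N) x.1).

(* The isomorphism A^{(x) m} -> Phi(m). *)
Fixpoint alg_power (A : algebra E) (m : nat) : {additive tpow (A 1%N) m -> A m} :=
  match m with
  | 0 => mkadd (mulrzDr (alg_one A))
  | m'.+1 => tlift (bi_pre idfun (alg_power A m') (alg_mu A 1%N m'))
  end.

Lemma HH0_power_subproofl (A : algebra E) m (t : tpow (A 1%N) m) :
  {morph (fun k : int => alg_power A m t *~ k) : k l / k + l}.
Proof. exact: mulrzDr. Qed.
Lemma HH0_power_subproofr (A : algebra E) m (k : int) :
  {morph (fun t : tpow (A 1%N) m => alg_power A m t *~ k) : t u / t + u}.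
Proof. by move=> t u; rewrite raddfD mulrzDl. Qed.
Definition HH0_power (A : algebra E) (m : nat) : {additive HH A (m, 0%N) -> A m} :=
  tlift (Biadd (@HH0_power_subproofl A m) (@HH0_power_subproofr A m)).

End Action.

(* Main.v *)
(* As C^n(Phi)(m) is generated by the pairings a . xi of elements a of Phi(k)
   with core morphisms xi : [k; 0] -> [m; n], a family of maps on Phi(k) which is
   compatible with the morphisms of E descends to C^n(Phi)(m) (a co-Yoneda
   argument).  The extension T acts on C^n(Phi)(m) by (a . xi) . f = a . (xi ; f),
   where xi ; f is again a core morphism because T and the core category agree on
   the morphisms out of [k; 0].

   For an algebra A, i.e. Phi split monoidal, the action is transported along the
   chain isomorphism C(A, A)^(x)n (x) A^(x)m = C^n(Phi)(m) built by adding one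
   Hochschild factor at a time.  Moving the factor l_(k+1) to the right past y
   costs the sign (-1)^(k|y|); for this to commute with the Hochschild
   differential the forests f_(n,k) must have degree n - k - 1. *)

Require Import Defs.
From mathcomp Require Import all_boot all_order all_algebra.
From mathcomp Require Import boolp.
From mathcomp Require Import zify ring.

Set Implicit Arguments.
Unset Strict Implicit.
Unset Printing Implicit Defensive.

Import GRing.Theory.
Local Open Scope ring_scope.

(** * Complexes, tensor products and direct sums *)

Definition ksgn (p : int) : int := (-1) ^+ `|p|%N.

(** Only the parity of the exponent matters, so the absolute value in [ksgn] is compatible with
    sums. *)
Lemma ksgnD p q : ksgn (p + q) = ksgn p * ksgn q.
Proof.
rewrite /ksgn -exprD -signr_odd -[in RHS]signr_odd; congr (_ ^+ nat_of_bool _).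
lia.
Qed.

Lemma ksgnM p q : ksgn (p * q) = ksign p q.
Proof. by rewrite /ksgn abszM. Qed.

Lemma ksgn_sqr p : ksgn p * ksgn p = 1.
Proof. by rewrite /ksgn -exprD -signr_odd addnn odd_double. Qed.

Section Homog.
Variable C : precomplex.
Implicit Types x y : C.

Lemma homog_pr p x : homog p (pr p x).
Proof. by rewrite /homog pr_pr eqxx. Qed.

Lemma pr_homog p q x : homog q x -> pr p x = if p == q then x else 0.
Proof. by move=> <-; rewrite pr_pr; case: eqP => [->|]. Qed.

(** Every element is the finite sum of its components. On homogeneous elements [eps] and [epsn]
    become explicit signs, which is where most identities below are checked. *)
Lemma homog_ind (P : C -> Prop) : P 0 -> (forall x y, P x -> P y -> P (x + y)) ->
  (forall p x, homog p x -> P x) -> forall x, P x.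
Proof.
move=> P0 PD Ph x; rewrite (suppE x); elim/big_ind: _ => // p _.
exact/Ph/homog_pr.
Qed.

Lemma homog0 p : homog p (0 : C). Proof. exact: raddf0. Qed.
Lemma homogD p x y : homog p x -> homog p y -> homog p (x + y).
Proof. by rewrite /homog raddfD => -> ->. Qed.
Lemma homogMz p x k : homog p x -> homog p (x *~ k).
Proof. by rewrite /homog raddfMz => ->. Qed.

Lemma eps_homog p x : homog p x -> eps C x = x *~ ksgn p.
Proof.
move=> hx; rewrite -[LHS]/(eps_fun x) /eps_fun.
(* The chosen support of x may miss p when x = 0, so p is added to it. *)
rewrite (@sum_supp _ _ (fun q z => z *~ (-1) ^+ `|q|%N) x (undup (p :: supp x))).
- rewrite (bigD1_seq p) ?undup_uniq ?mem_undup ?mem_head //= hx big1 ?addr0 //.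
  by move=> q /negPf qp; rewrite (pr_homog _ hx) qp mul0rz.
- by move=> q; rewrite mul0rz.
- exact: undup_uniq.
by move=> q qx; rewrite mem_undup inE qx orbT.
Qed.

Lemma homog_eps p x : homog p x -> homog p (eps C x).
Proof. by move=> hx; rewrite (eps_homog hx); apply: homogMz. Qed.

Lemma epsn_homog n p x : homog p x -> epsn C n x = x *~ ksgn (n%:Z * p).
Proof.
move=> hx; rewrite ksgnM /ksign absz_nat -signr_odd oddM /epsn.
by case: ifP => on; rewrite ?(eps_homog hx) /= ?signr_odd.
Qed.

Lemma homog_epsn n p x : homog p x -> homog p (epsn C n x).
Proof. by move=> hx; rewrite (epsn_homog n hx); apply: homogMz. Qed.

Lemma epsnK n : involutive (epsn C n).
Proof.
elim/homog_ind => [|x y|p x hx]; first by rewrite !raddf0.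
  by rewrite !raddfD => -> ->.
by rewrite (epsn_homog n hx) raddfMz (epsn_homog n hx) -mulrzA ksgn_sqr.
Qed.

End Homog.

(** * Chain maps as a property of additive maps *)

Record chain_prop (C D : precomplex) (f : {additive C -> D}) : Prop := {
  chainp_homog : forall p x, homog p x -> homog p (f x);
  chainp_df : forall x, f (df x) = df (f x) }.

Lemma chainp_pr (C D : precomplex) (f : {additive C -> D}) :
  (forall p x, homog p x -> homog p (f x)) -> forall p x, f (pr p x) = pr p (f x).
Proof.
move=> fh p; elim/homog_ind => [|x y|q x hx]; first by rewrite !raddf0.
  by rewrite !raddfD => -> ->.
by rewrite (pr_homog _ hx) (pr_homog _ (fh _ _ hx)); case: eqP; rewrite ?raddf0.
Qed.

Lemma chain_map_prop (C D : precomplex) (f : chain_map C D) : chain_prop f.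
Proof.
by split=> [p x hx|x]; [rewrite /homog -chain_pr hx|apply: chain_df].
Qed.

Definition chain_of (C D : precomplex) (f : {additive C -> D}) (h : chain_prop f) :
  chain_map C D := ChainMap (chainp_pr (chainp_homog h)) (chainp_df h).

Lemma chainp_eps (C D : precomplex) (f : {additive C -> D}) :
  (forall p x, homog p x -> homog p (f x)) -> forall x, f (eps C x) = eps D (f x).
Proof.
move=> fh; elim/homog_ind => [|x y|q x hx]; first by rewrite !raddf0.
  by rewrite !raddfD => -> ->.
by rewrite (eps_homog hx) (eps_homog (fh _ _ hx)) raddfMz.
Qed.

Lemma chainp_inv (C D : precomplex) (f : {additive C -> D}) (g : {additive D -> C}) :
  cancel f g -> cancel g f -> chain_prop f -> chain_prop g.
Proof.
move=> fK gK fc; split=> [p x hx|x]; apply: (can_inj fK); last first.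
  by rewrite (chainp_df fc) !gK.
by rewrite gK -{2}hx (chainp_pr (chainp_homog fc)) gK.
Qed.

(** * Biadditive maps and Koszul signs *)

Section BiMulz.
Variables (A B C : zmodType) (f : biadd A B C).

Lemma bi_mulzl x y k : f (x *~ k) y = f x y *~ k.
Proof. exact: raddfMz (bi_l f y) k x. Qed.
Lemma bi_mulzr x y k : f x (y *~ k) = f x y *~ k.
Proof. exact: raddfMz (bi_r f x) k y. Qed.

End BiMulz.

Section BiSign.
Variables A B C : precomplex.
Variable f : biadd A B C.

Definition bihomog :=
  forall p q x y, homog p x -> homog q y -> homog (p + q) (f x y).

Lemma bi_homog_ind (P : C -> Prop) : P 0 -> (forall x y, P x -> P y -> P (x + y)) ->
  (forall p q x y, homog p x -> homog q y -> P (f x y)) -> forall x y, P (f x y).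
Proof.
move=> P0 PD Ph x y; elim/homog_ind: x => [|x x' Px Px'|p x hx].
- by rewrite bi0l.
- by rewrite biaddl; apply: PD.
elim/homog_ind: y => [|y y' Py Py'|q y hy].
- by rewrite bi0r.
- by rewrite biaddr; apply: PD.
exact: Ph hx hy.
Qed.

(** For statements about x and y themselves, and not only about a value of a biadditive map, such as
    [bi_eps]. *)
Lemma bi_homog_ind2 (P : A -> B -> Prop) :
  (forall y, P 0 y) -> (forall x, P x 0) ->
  (forall x x' y, P x y -> P x' y -> P (x + x') y) ->
  (forall x y y', P x y -> P x y' -> P x (y + y')) ->
  (forall p q x y, homog p x -> homog q y -> P x y) -> forall x y, P x y.
Proof.
move=> P0l P0r PDl PDr Ph x y; elim/homog_ind: x => [//|x x'|p x hx]; first exact: PDl.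
elim/homog_ind: y => [//|y y'|q y hy]; first exact: PDr.
exact: Ph hx hy.
Qed.

(** The sign (-1)^(p + q) is the product of (-1)^p and (-1)^q. *)
Lemma bi_eps : bihomog -> forall x y, f (eps A x) (eps B y) = eps C (f x y).
Proof.
move=> fh; apply: bi_homog_ind2 => [y|x|x x' y e e'|x y y' e e'|p q x y hx hy].
- by rewrite raddf0 !bi0l raddf0.
- by rewrite raddf0 !bi0r raddf0.
- by rewrite raddfD !biaddl raddfD e e'.
- by rewrite raddfD !biaddr raddfD e e'.
rewrite (eps_homog hx) (eps_homog hy) (eps_homog (fh _ _ _ _ hx hy)).
by rewrite bi_mulzl bi_mulzr -mulrzA ksgnD mulrC.
Qed.

Lemma bi_epsn : bihomog ->
  forall n x y, f (epsn A n x) (epsn B n y) = epsn C n (f x y).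
Proof. by move=> fh n x y; rewrite /epsn; case: ifP => // _; apply: bi_eps. Qed.

End BiSign.

(** * Chain maps out of tensor products *)

Lemma tpair_bichain (A B : precomplex) :
  @bichain A B (tensor A B) (tpair A B).
Proof.
split=> [p q x y hx hy|x y]; last exact: tliftE.
by rewrite /homog; rewrite [LHS](tens_pr_homog _ hx hy) eqxx.
Qed.

Lemma tpair_df (A B : precomplex) (a : A) (b : B) : @df (tensor A B) (tpair A B a b) =
  tpair A B (df a) b + tpair A B (eps A a) (df b).
Proof. exact: tliftE. Qed.

Lemma eps_tpair (A B : precomplex) (a : A) (b : B) :
  eps (tensor A B) (tpair A B a b) = tpair A B (eps A a) (eps B b).
Proof. by rewrite -(bi_eps (bichain_homog (tpair_bichain A B))). Qed.

Section TLift.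
Variables A B C : precomplex.

(** The shift s covers maps with a further homogeneous argument held fixed, as in [tassoc_chain]. *)
Lemma tlift_homog (f : biadd A B C) (s : int) :
  (forall p q x y, homog p x -> homog q y -> homog (p + q + s) (f x y)) ->
  forall p (t : tensor A B), homog p t -> homog (p + s) (tlift f t).
Proof.
(* Replacing t by [pr p t] makes the claim additive in t: the summands of a homogeneous t need not
   be homogeneous. *)
move=> fh p t ht; rewrite -ht; elim/ztens_ind: t {ht} => [|a b t IHt].
  by rewrite !raddf0; apply: homog0.
rewrite !raddfD; apply: homogD IHt; rewrite [pr p _]tens_prE /tens_pr_fun.
rewrite raddf_sum; apply: (big_ind (homog (p + s))) => [||i _].
- exact: homog0.
- by move=> *; apply: homogD.
rewrite tliftE; have := fh i (p - i) _ _ (homog_pr i a) (homog_pr (p - i) b).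
by rewrite (addrC i) subrK.
Qed.

Lemma tlift_chain (f : biadd A B C) :
  bichain f -> @chain_prop (tensor A B) C (tlift f).
Proof.
case=> fh fd; split=> [p t ht|].
  rewrite -[p]addr0; apply: tlift_homog ht => i j x y hx hy.
  by rewrite addr0; apply: fh.
elim/ztens_ind => [|a b t IHt]; first by rewrite !raddf0.
rewrite !raddfD IHt; congr (_ + _).
have -> : @df (tensor A B) (tpair A B a b) = tens_df_fun a b by apply: tliftE.
by rewrite raddfD !tliftE fd.
Qed.

End TLift.

Lemma bichain_pre (A B A' B' C : precomplex) (h : {additive A' -> A})
    (k : {additive B' -> B}) (f : biadd A B C) :
  chain_prop h -> chain_prop k -> bichain f -> bichain (bi_pre h k f).
Proof.
move=> hch kc [fh fd]; split=> [p q x y hx hy|x y] /=.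
  by apply: fh; apply: chainp_homog.
by rewrite fd !(chainp_df hch, chainp_df kc) (chainp_eps (chainp_homog hch)).
Qed.

Lemma bichain_post (A B C C' : precomplex) (h : {additive C -> C'}) (f : biadd A B C) :
  chain_prop h -> bichain f -> bichain (bi_post h f).
Proof.
move=> hch [fh fd]; split=> [p q x y hx hy|x y] /=.
  by apply: chainp_homog; last exact: fh.
by rewrite -(chainp_df hch) fd raddfD.
Qed.

Lemma id_chain (C : precomplex) : @chain_prop C C idfun.
Proof. by split. Qed.

Lemma tmap_chain (A B A' B' : precomplex) (f : {additive A -> A'}) (g : {additive B -> B'}) :
  chain_prop f -> chain_prop g -> @chain_prop (tensor A B) (tensor A' B') (tmap f g).
Proof. by move=> fc gc; apply/tlift_chain/bichain_pre/tpair_bichain. Qed.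

Lemma tmapE (A B A' B' : zmodType) (f : {additive A -> A'}) (g : {additive B -> B'}) x y :
  tmap f g (tpair A B x y) = tpair A' B' (f x) (g y).
Proof. exact: tliftE. Qed.

(** The inverse of an additive bijection is additive; [cid2] extracts it as data, [bijective] being
    a mere proposition. *)
Lemma bij_additive (A B : zmodType) (f : {additive A -> B}) :
  bijective f -> {g : {additive B -> A} | cancel f g & cancel g f}.
Proof.
move=> bf; have /cid2[g fK gK] : exists2 g : B -> A, cancel f g & cancel g f.
  by case: bf => g; exists g.
have gD : {morph g : x y / x + y}.
  by move=> x y; apply: (can_inj fK); rewrite raddfD !gK.
by exists (mkadd gD).
Qed.

Lemma tmap_bij (A B A' B' : zmodType) (f : {additive A -> A'}) (g : {additive B -> B'}) :
  bijective f -> bijective g -> bijective (tmap f g).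
Proof.
move=> /bij_additive[f' fK f'K] /bij_additive[g' gK g'K]; exists (tmap f' g').
  elim/ztens_ind => [|a b t IHt]; first by rewrite !raddf0.
  by rewrite !raddfD IHt !tmapE fK gK.
elim/ztens_ind => [|a b t IHt]; first by rewrite !raddf0.
by rewrite !raddfD IHt !tmapE f'K g'K.
Qed.

(** * Swap and associativity of tensor products *)

Section Swap.
Variables A B : zmodType.
(** No Koszul sign is included: this swap serves for bijectivity, a matter of underlying groups. *)
Definition tswap : {additive ztens A B -> ztens B A} := tlift (bi_flip (tpair B A)).
Lemma tswapE a b : tswap (tpair A B a b) = tpair B A b a. Proof. exact: tliftE. Qed.
End Swap.

Lemma tswapK (A B : zmodType) : cancel (tswap A B) (tswap B A).
Proof.
elim/ztens_ind => [|a b t IHt]; first by rewrite !raddf0.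
by rewrite !raddfD IHt !tswapE.
Qed.

Lemma tlift_flip_bij (A B C : zmodType) (f : biadd A B C) :
  bijective (tlift (bi_flip f)) -> bijective (tlift f).
Proof.
move=> bf; have bs : bijective (tswap A B) by exists (tswap B A); apply: tswapK.
apply: (eq_bij (bij_comp bf bs)) => t; rewrite -[LHS]/(tlift _ (tswap _ _ t)).
elim/ztens_ind: t => [|a b t IHt]; first by rewrite !raddf0.
by rewrite !raddfD IHt tswapE !tliftE.
Qed.

Section Assoc.
Variables A B C : precomplex.

(** Since [tlift] handles two variables, the trilinear map is lifted in a and b first, with c held
    fixed. *)
Definition tassoc_bi (c : C) : biadd A B (tensor A (tensor B C)) :=
  bi_pre idfun (bi_l (tpair B C) c) (tpair A (tensor B C)).
Lemma tassoc_biE c a b :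
  tassoc_bi c a b = tpair A (tensor B C) a (tpair B C b c).
Proof. by []. Qed.
Lemma tassoc_subproofl c : {morph tlift (tassoc_bi c) : t u / t + u}.
Proof. exact: raddfD. Qed.
Lemma tassoc_subproofr t : {morph (fun c => tlift (tassoc_bi c) t) : c c' / c + c'}.
Proof.
move=> c c'; elim/ztens_ind: t => [|a b t IHt]; first by rewrite !raddf0 addr0.
rewrite !raddfD IHt addrACA; congr (_ + _).
by rewrite !tliftE !tassoc_biE biaddr [LHS]biaddr.
Qed.
Definition tassoc_tri : biadd (tensor A B) C (tensor A (tensor B C)) :=
  Biadd tassoc_subproofl tassoc_subproofr.
Lemma tassoc_triE t c : tassoc_tri t c = tlift (tassoc_bi c) t.
Proof. by []. Qed.
Definition tassoc : {additive tensor (tensor A B) C -> tensor A (tensor B C)} :=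
  tlift tassoc_tri.

Lemma tassocE a b c :
  tassoc (tpair (tensor A B) C (tpair A B a b) c) = 
  tpair A (tensor B C) a (tpair B C b c).
Proof. by rewrite [LHS]tliftE [LHS]tliftE. Qed.

End Assoc.

Lemma tassoc_chain (A B C : precomplex) : chain_prop (tassoc A B C).
Proof.
apply: tlift_chain; split=> [p q t c ht hcoef|t c]; rewrite !tassoc_triE.
  apply: tlift_homog ht => i j x y hx hy; rewrite -addrA.
  by apply: (bichain_homog (tpair_bichain _ _)) => //; apply: (bichain_homog (tpair_bichain _ _)).
elim/ztens_ind: t => [|a b t IHt]; first by rewrite !raddf0 addr0.
rewrite !raddfD IHt addrACA; congr (_ + _).
have E x y z : tlift (tassoc_bi A B z) (tpair A B x y) =
    tpair A (tensor B C) x (tpair B C y z) by exact: tliftE.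
rewrite tpair_df eps_tpair raddfD !E.
by rewrite [LHS]tpair_df tpair_df biaddr addrA.
Qed.

Lemma tassoc_bij (A B C : precomplex) : bijective (tassoc A B C).
Proof.
(* The inverse is built symmetrically, lifting in b and c with a held fixed. *)
pose b2 a := bi_pre (bi_r (tpair A B) a) idfun (tpair (tensor A B) C).
have b2E a b c : b2 a b c = tpair (tensor A B) C (tpair A B a b) c by [].
have b2D u : {morph (fun a => tlift (b2 a) u) : a a' / a + a'}.
  move=> a a'; elim/ztens_ind: u => [|b c u IHu]; first by rewrite !raddf0 addr0.
  rewrite !raddfD IHu addrACA; congr (_ + _).
  by rewrite !tliftE !b2E biaddl [LHS]biaddl.
exists (tlift (Biadd b2D (fun a => raddfD (tlift (b2 a))))) => t.
  elim/ztens_ind: t => [|t c u IHu]; first by rewrite !raddf0.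
  rewrite !raddfD IHu; congr (_ + _).
  elim/ztens_ind: t => [|a b t IHt]; first by rewrite bi0l !raddf0.
  by rewrite biaddl !raddfD IHt tassocE [X in X + _]tliftE [X in X + _]tliftE.
elim/ztens_ind: t => [|a t u IHu]; first by rewrite !raddf0.
rewrite !raddfD IHu; congr (_ + _).
elim/ztens_ind: t => [|b c t IHt]; first by rewrite bi0r !raddf0.
by rewrite biaddr !raddfD IHt [X in tassoc _ _ _ X]tliftE [X in tassoc _ _ _ X]tliftE b2E tassocE.
Qed.

(** * Universal property of direct sums *)

Section DsumIn.
Variable V : nat -> zmodType.

(** Matching on the proof [eqP] provides the equality along which v is transported from [V k] to
    [V n]. *)
Definition dsum_in_fun k (v : V k) (n : nat) : V n :=
  if @eqP _ k n is ReflectT e then ecast z (V z) e v else 0.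

Lemma dsum_in_fin k (v : V k) :
  exists N, forall n, (N <= n)%N -> dsum_in_fun v n = 0.
Proof.
exists k.+1 => n kn; rewrite /dsum_in_fun; case: eqP => // e.
by exfalso; move: kn; rewrite e ltnn.
Qed.

Lemma dsum_in_add k : {morph (fun v : V k => DSum (dsum_in_fin v)) : v w / v + w}.
Proof.
move=> v w; apply: dsumP => n; rewrite dsumD /= /dsum_in_fun.
by case: eqP => [e|_]; [case: n / e|rewrite addr0].
Qed.

Definition dsum_in k : {additive V k -> dsum V} := mkadd (@dsum_in_add k).

Lemma dsum_in_same k v : dsum_in k v k = v.
Proof. by rewrite /= /dsum_in_fun; case: eqP => // e; rewrite (eq_irrelevance e erefl). Qed.

Lemma dsum_in_neq k n v : k != n -> dsum_in k v n = 0.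
Proof. by rewrite /= /dsum_in_fun; case: eqP. Qed.

Lemma dsum_decomp (x : dsum V) : x = \sum_(k < dbound x) dsum_in k (x k).
Proof.
apply: dsumP => n; rewrite dsum_sum_app; have [nx|xn] := ltnP n (dbound x).
  rewrite (bigD1 (Ordinal nx)) // big1 => [|k]; first by rewrite dsum_in_same; rewrite [RHS]addr0.
  by rewrite -val_eqE; apply: dsum_in_neq.
rewrite big1 ?dboundP // => k _; apply: dsum_in_neq.
by rewrite neq_ltn (leq_trans (ltn_ord k)).
Qed.

Lemma dsum_ind (P : dsum V -> Prop) : P 0 -> (forall x y, P x -> P y -> P (x + y)) ->
  (forall k v, P (dsum_in k v)) -> forall x, P x.
Proof. by move=> P0 PD Pin x; rewrite (dsum_decomp x); elim/big_ind: _. Qed.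

Variables (W : zmodType) (h : forall k, {additive V k -> W}).

(** The map out of the direct sum with components h; the predicate [xpredT] gives the sum the shape
    expected by [dsum_sum_add]. *)
Definition dsum_out_fun (x : dsum V) : W := \sum_(n < dbound x | xpredT (n : nat)) h n (x n).
Lemma dsum_out_add : {morph dsum_out_fun : x y / x + y}.
Proof. exact: (@dsum_sum_add _ _ xpredT h (fun n => raddfD (h n))). Qed.
Definition dsum_out : {additive dsum V -> W} := mkadd dsum_out_add.

Lemma dsum_out_in k v : dsum_out (dsum_in k v) = h k v.
Proof.
(* The bound chosen by [dbound] is opaque; k + 1 is an explicit bound for an element concentrated in
   component k. *)
rewrite -[LHS]/(dsum_out_fun _) /dsum_out_fun (@dsum_sumE _ _ xpredT h _ k.+1).
- rewrite big_ord_recr big1 => [|n _]; first by rewrite dsum_in_same [LHS]add0r.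
  by rewrite dsum_in_neq ?raddf0 // neq_ltn (ltn_ord n) orbT.
- by move=> n; rewrite raddf0.
by move=> n kn; apply: dsum_in_neq; rewrite neq_ltn kn.
Qed.

End DsumIn.

Lemma dsum_in_natural (V W : nat -> zmodType) (f : forall n, V n -> W n) k v n :
  (forall n, f n 0 = 0) -> f n (dsum_in V k v n) = dsum_in W k (f k v) n.
Proof.
move=> f0; rewrite /= /dsum_in_fun; case: eqP => [e|_]; last exact: f0.
by case: n / e.
Qed.

(** * Tensor products commute with direct sums *)

Section DsumBij.
Variables (V W : nat -> zmodType) (P : zmodType).

(** The inverses on the components, followed by the inclusions of the [V n], assemble into an
    inverse by the universal property. *)
Lemma tlift_dsum_bir_bij (f : forall n, biadd P (V n) (W n)) :
  (forall n, bijective (tlift (f n))) -> bijective (tlift (dsum_bir f)).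
Proof.
move=> fb; pose g n := s2val (bij_additive (fb n)).
have fK n : cancel (tlift (f n)) (g n) by rewrite /g; case: (bij_additive _).
have gK n : cancel (g n) (tlift (f n)) by rewrite /g; case: (bij_additive _).
pose h n : {additive W n -> ztens P (dsum V)} := tmap idfun (dsum_in V n) \o g n.
have hgE n w : h n w = tmap idfun (dsum_in V n) (g n w) by [].
have hE n a v : h n (f n a v) = tpair P (dsum V) a (dsum_in V n v).
  by rewrite -tliftE hgE fK tmapE.
exists (dsum_out h); last first.
  elim/dsum_ind => [|x y ex ey|k w]; first by rewrite !raddf0.
    by rewrite !raddfD ex ey.
  rewrite dsum_out_in hgE -[in RHS](gK k w); elim/ztens_ind: (g k w) => [|a v t IHt].
    by rewrite !raddf0.
  rewrite !raddfD IHt tmapE !tliftE; congr (_ + _); apply: dsumP => n.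
  by rewrite -(@dsum_in_natural _ _ (fun n => f n a)) // => m; rewrite bi0r.
elim/ztens_ind => [|a x t IHt]; first by rewrite !raddf0.
rewrite !raddfD IHt tliftE; congr (_ + t) => {t IHt}.
elim/dsum_ind: x => [|x y ex ey|k v]; first by rewrite !bi0r raddf0.
  by rewrite !biaddr raddfD ex ey.
rewrite -hE -[RHS](dsum_out_in h); congr (dsum_out h _); apply: dsumP => n.
by rewrite -(@dsum_in_natural _ _ (fun n => f n a)) // => m; rewrite bi0r.
Qed.

Lemma tlift_dsum_bil_bij (f : forall n, biadd (V n) P (W n)) :
  (forall n, bijective (tlift (f n))) -> bijective (tlift (dsum_bil f)).
Proof.
move=> fb; apply: tlift_flip_bij.
have fb' n : bijective (tlift (bi_flip (f n))).
  by apply: tlift_flip_bij; apply: (@eq_bij _ _ _ (fb n)).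
apply: (@eq_bij _ _ _ (tlift_dsum_bir_bij fb')).
elim/ztens_ind => [|a x t IHt]; first by rewrite !raddf0.
by rewrite !raddfD IHt !tliftE; congr (_ + _); apply: dsumP.
Qed.

End DsumBij.

(** * The degree of the forests f_(n,k) *)

Lemma card_ord_lt n r : (r <= n)%N -> #|[set i : 'I_n | (i < r)%N]| = r.
Proof.
move=> rn; rewrite -sum1_card (eq_bigl (fun i : 'I_n => i < r)%N) => [|i].
  by rewrite -(big_ord_widen _ (fun=> 1%N)) // sum1_card card_ord.
by rewrite inE.
Qed.

(** The position [cpos] is a rotation of ['I_n], and [moved] is the preimage of an initial segment
    under it; k > 0 makes its length n + 1 - k at most n. *)
Lemma card_moved n k (j : 'I_n) : (0 < k)%N -> #|moved n k j| = nmoved n k.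
Proof.
move=> k0; have n0 : (0 < n)%N := leq_ltn_trans (leq0n _) (ltn_ord j).
pose f (a : 'I_n) : 'I_n := Ordinal (ltn_pmod (a + n - j) n0).
have fI : injective f.
  move=> a b /(congr1 val) /= /eqP; rewrite -!addnBA ?(ltnW (ltn_ord j)) //.
  by rewrite eqn_modDr !modn_small // => /eqP/val_inj.
have -> : moved n k j = f @^-1: [set i : 'I_n | (i < nmoved n k)%N].
  by apply/setP => a; rewrite !inE.
rewrite on_card_preimset; last exact/onW_bij/injF_bij.
by rewrite card_ord_lt // /nmoved leq_subLR -addn1 addnC leq_add2r.
Qed.

(** The only vertex has the n + 1 - k moved leaves above it and one half-edge below, so its valence
    is n + 2 - k and its degree n - k - 1. *)
Lemma fdeg_blowup n k (j : 'I_n) (F : forest n k) : (0 < k)%N ->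
  is_blowup j (val F) -> fdeg (val F) = n%:Z - k%:Z - 1.
Proof.
case: F => F /= /and4P[_ _ vok _] k0 /and3P[_ _ /eqP Fv].
(* Validity of the forest gives at least two moved leaves: singletons are then proper subsets of the
   vertex, and the truncated subtraction in [nmoved] is exact. *)
have c2 : (1 < #|moved n k j|)%N.
  by move/forall_inP: vok => /(_ (moved n k j)); rewrite Fv inE eqxx => /(_ isT) /andP[].
rewrite /fdeg Fv big_set1 /valence.
have -> : fchildren F (moved n k j) = [set [set a] | a in moved n k j].
  apply/setP => K; rewrite !inE Fv inE; apply/idP/imsetP => [|[a am ->]].
    case/and3P=> /andP[/orP[/eqP->|/cards1P[a ->]] _]; first by rewrite properxx.
    by rewrite properE sub1set => /andP[am _] _; exists a.
  have aP : [set a] \proper moved n k j by rewrite properEcard sub1set am cards1.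
  rewrite cards1 eqxx orbT aP /=; apply/andP; split.
    by apply/existsP; exists (moved n k j); rewrite inE eqxx.
  apply/existsP => -[B]; rewrite inE => /and3P[/eqP-> _].
  by rewrite properxx.
rewrite card_imset; last exact: set1_inj.
move: c2; rewrite card_moved // /nmoved => c2; lia.
Qed.

(** This degree gives the sign for moving the forests past the second factor in
    [hoch_mul0_bichain]. *)
Lemma fL_homog n k : (0 < k)%N -> homog (n%:Z - k%:Z - 1) (fL n k).
Proof.
move=> k0; apply/ffunP => F; rewrite !ffunE.
have [FN|Fn] := eqVneq (fdeg (val F)) (n%:Z - k%:Z - 1); first by [].
rewrite big1 // => j bF; by rewrite (fdeg_blowup k0 bF) eqxx in Fn.
Qed.

(** * Iterated Hochschild complexes *)

Section HochCoef.
Variables (E : prop) (i : ainf_mult E) (Phi : functor_data E).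
Implicit Types (m k n : nat).

(** Typed on [hoch i Phi m], so that rewriting sees the complex and not the bare direct sum. *)
Definition hcoef m (x : hoch i Phi m) k : Phi (k.+1 + m)%N :=
  dsum_fun (x : hoch_obj_sum Phi m) k.

(** The morphism by which the differential goes from component n to component k; the successors
    appear because component n belongs to l_(n+1). *)
Definition fLm n k m : mor E (n.+1 + m)%N (k.+1 + m)%N :=
  tens (i n.+1 k.+1 (fL n.+1 k.+1)) (idm m).

Lemma hcoefP m (x y : hoch i Phi m) : (forall k, hcoef x k = hcoef y k) -> x = y.
Proof. exact: dsumP. Qed.

Lemma hcoef_fin m (x : hoch i Phi m) : exists N, forall n, (N <= n)%N -> hcoef x n = 0.
Proof. exact: dsum_fin. Qed.

Lemma hcoefD m (x y : hoch i Phi m) k : hcoef (x + y) k = hcoef x k + hcoef y k.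
Proof. by []. Qed.
Lemma hcoef0 m k : hcoef (0 : hoch i Phi m) k = 0.
Proof. by []. Qed.
Lemma hcoefMz m (x : hoch i Phi m) z k : hcoef (x *~ z) k = hcoef x k *~ z.
Proof. exact: (raddfMz (mkadd (fun x y => hcoefD x y k)) z x). Qed.

(** Component k is paired with l_(k+1), which has degree k. *)
Lemma hcoef_homog m (x : hoch i Phi m) p :
  homog p x <-> forall k, homog (p - k%:Z) (hcoef x k).
Proof.
split=> [hx k|hx]; first by rewrite /homog -[in RHS]hx.
by apply: hcoefP => k; apply: hx.
Qed.

Lemma hcoef_eps m (x : hoch i Phi m) k : hcoef (eps _ x) k = eps _ (hcoef x k) *~ ksgn k%:Z.
Proof.
elim/homog_ind: x => [|x y|p x hx]; first by rewrite raddf0 !hcoef0 raddf0 mul0rz.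
  by rewrite raddfD !hcoefD => -> ->; rewrite raddfD mulrzDl.
rewrite (eps_homog hx) hcoefMz; move/hcoef_homog/(_ k)/eps_homog: hx => ->.
by rewrite -mulrzA -ksgnD subrK.
Qed.

(** Any bound N may replace the chosen one, so that several elements can share the same range of
    summation. *)
Lemma hcoef_df m (x : hoch i Phi m) k N : (forall n, (N <= n)%N -> hcoef x n = 0) ->
  hcoef (df x) k = df (hcoef x k) + \sum_(n < N | (k < n)%N) fact (eps _ (hcoef x n)) (fLm n k m).
Proof.
move=> xN; congr (_ + _).
apply: (@dsum_sumE _ _ (fun n => k < n)%N (fun n z => fact (eps _ z) (fLm n k m))) => //.
by move=> n; rewrite raddf0 bi0l.
Qed.

Lemma hcoef_act m m' (x : hoch i Phi m) (g : mor E m m') k :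
  hcoef (fact x g : hoch i Phi m') k =
  fact (hcoef x k) (tens (idm k.+1) (epsn _ k g) : mor E (k.+1 + m)%N (k.+1 + m')%N).
Proof. by []. Qed.

End HochCoef.

(** * Products commuting with the right action of the prop *)

Section RightLinear.
Variables (E : prop) (i : ainf_mult E) (P : precomplex).

(** The condition under which a product applied componentwise commutes with the grafting part of the
    Hochschild differential, which is a right action of forests. *)
Definition rlinear (Psi Theta : functor_data E) (b : forall m, biadd P (Psi m) (Theta m)) :=
  forall m m' p y (g : mor E m m'), fact (b m p y) g = b m' p (fact y g).

Variables (Psi Theta : functor_data E) (b : forall m, biadd P (Psi m) (Theta m)).

Definition hoch_bir m : biadd P (hoch i Psi m) (hoch i Theta m) :=
  dsum_bir (fun k => b (k.+1 + m)%N).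

Lemma hcoef_bir m p (y : hoch i Psi m) k : hcoef (hoch_bir m p y) k = b (k.+1 + m)%N p (hcoef y k).
Proof. by []. Qed.

Lemma hoch_bir_rlinear : rlinear b -> rlinear hoch_bir.
Proof. by move=> bl m m' p y g; apply: hcoefP => k; rewrite hcoef_act !hcoef_bir bl. Qed.

(** The factor l_(k+1) stays on the far right, so no new sign arises; right linearity moves the
    forests of the differential across b. *)
Lemma hoch_bir_bichain : rlinear b -> (forall m, bichain (b m)) ->
  forall m, bichain (hoch_bir m).
Proof.
move=> bl bc m; split=> [p q x y hx hy|p y].
  apply/hcoef_homog => k; rewrite hcoef_bir -addrA.
  by apply: (bichain_homog (bc _)) => //; move/hcoef_homog: hy; apply.
have [N yN] := hcoef_fin y; apply: hcoefP => k; rewrite hcoefD !hcoef_bir.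
rewrite !(hcoef_df _ (N := N)) //; last by move=> n /yN e; rewrite hcoef_bir e bi0r.
rewrite hcoef_bir (bichain_df (bc _)) biaddr addrA bi_sumr; congr (_ + _).
apply: eq_bigr => n _; rewrite hcoef_bir -(bi_eps (bichain_homog (bc _))).
by rewrite bl.
Qed.

Lemma hoch_bir_bij : (forall m, bijective (tlift (b m))) ->
  forall m, bijective (tlift (hoch_bir m)).
Proof. by move=> bb m; apply: tlift_dsum_bir_bij => k; apply: bb. Qed.

End RightLinear.

(** * The pairing of a functor with core morphisms *)

Section Functors.
Variables (E : prop) (i : ainf_mult E).

Lemma prop_dgcat : is_dgcat E.
Proof. exact: mon_dgcat (prop_moncat (prop_axioms E)). Qed.

Section Pre.
Variable Phi : functor_data E.

(** The pairing a . xi of an element a of Phi(k) with a core morphism xi : [k; 0] -> [m; n]. *)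
Fixpoint fpre (n k m : nat) : biadd (Phi k) (ihoch i n (corep E k) m) (ihoch i n Phi m) :=
  match n with
  | 0 => @fact _ Phi k m
  | n'.+1 => hoch_bir i (fpre n' k) m
  end.

Lemma hcoef_fpre n k m a (xi : ihoch i n.+1 (corep E k) m) j :
  hcoef (fpre n.+1 k m a xi : hoch i _ m) j = fpre n k (j.+1 + m)%N a (hcoef (xi : hoch i _ m) j).
Proof. by []. Qed.

Hypothesis Pf : is_functor Phi.

Lemma fpre_rlinear n k : rlinear (fpre n k).
Proof.
elim: n => [|n IHn]; last exact: hoch_bir_rlinear.
by move=> m m' p y g; rewrite /= -(fact_comp Pf).
Qed.

Lemma fpre_bichain n k m : bichain (fpre n k m).
Proof.
elim: n m => [|n IHn] m; first exact: fact_chain Pf k m.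
by apply: hoch_bir_bichain => //; apply: fpre_rlinear.
Qed.

(** The pairing is balanced over E: in each component this is associativity of the action. *)
Lemma fpre_fact n k k' m a (phi : mor E k k') (xi : ihoch i n (corep E k') m) :
  fpre n k' m (fact a phi) xi = fpre n k m a (precomp i n k k' m phi xi).
Proof.
elim: n m xi => [|n IHn] m xi; first by rewrite /= (fact_comp Pf).
by apply: (@hcoefP _ i (ihoch i n Phi) m) => j; rewrite !hcoef_fpre IHn.
Qed.

End Pre.
End Functors.

(** * The co-Yoneda argument *)

Section CoYoneda.
Variables (E : prop) (i : ainf_mult E) (Phi : functor_data E).
Hypothesis Pf : is_functor Phi.

Lemma dsum_in_fpre n k m j a (xi : ihoch i n (corep E k) (j.+1 + m)%N) :
  dsum_in (fun l => ihoch i n Phi (l.+1 + m)%N) j (fpre i Phi n k (j.+1 + m)%N a xi) =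
  fpre i Phi n.+1 k m a (dsum_in (fun l => ihoch i n (corep E k) (l.+1 + m)%N) j xi).
Proof.
apply: dsumP => l; symmetry.
apply: (@dsum_in_natural (fun l => ihoch i n (corep E k) (l.+1 + m)%N)
   (fun l => ihoch i n Phi (l.+1 + m)%N) (fun l => fpre i Phi n k (l.+1 + m)%N a)) => l'.
exact: bi0r.
Qed.

(** For n = 0 every u is u . id; each component of C^(n+1)(Phi) is a value of C^n(Phi), so pairings
    generate by induction. *)
Lemma ihoch_ind n m (P : ihoch i n Phi m -> Prop) :
  P 0 -> (forall u v, P u -> P v -> P (u + v)) ->
  (forall k a xi, P (fpre i Phi n k m a xi)) -> forall u, P u.
Proof.
elim: n m P => [|n IHn] m P P0 PD Pp.
  by move=> u; rewrite -[u](fact_id Pf); apply: (Pp m u (idm m)).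
apply: (@dsum_ind (fun l => ihoch i n Phi (l.+1 + m)%N)) => // j.
apply: IHn => [|u v Pu Pv|k a xi]; first by rewrite raddf0.
  by rewrite raddfD; apply: PD.
by rewrite dsum_in_fpre.
Qed.

Lemma ihoch_homog_ind n m (P : ihoch i n Phi m -> Prop) :
  P 0 -> (forall u v, P u -> P v -> P (u + v)) ->
  (forall k p q a xi, homog p a -> homog q xi -> P (fpre i Phi n k m a xi)) ->
  forall u, P u.
Proof.
move=> P0 PD Pp; apply: ihoch_ind => // k; apply: bi_homog_ind => // p q a xi.
exact: Pp.
Qed.

Variable W : zmodType.

(** The descent of the family h: for n = 0 an element u = u . id goes to the value of h at u and id,
    and the general case works component by component. Compatibility of h with E enters in
    [ilift_fpre]. *)
Fixpoint ilift n m : (forall k, biadd (Phi k) (ihoch i n (corep E k) m) W) ->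
    {additive ihoch i n Phi m -> W} :=
  match n with
  | 0 => fun h => bi_l (h m) (idm m)
  | n'.+1 => fun h => dsum_out (fun j => ilift (fun k =>
      bi_pre idfun (dsum_in (fun l => ihoch i n' (corep E k) (l.+1 + m)%N) j) (h k)))
  end.

Lemma dsum_in_precomp n k k' m j phi (xi : ihoch i n (corep E k') (j.+1 + m)%N) :
  dsum_in (fun l => ihoch i n (corep E k) (l.+1 + m)%N) j (precomp i n k k' (j.+1 + m)%N phi xi) =
  precomp i n.+1 k k' m phi (dsum_in (fun l => ihoch i n (corep E k') (l.+1 + m)%N) j xi).
Proof.
apply: dsumP => l; symmetry.
apply: (@dsum_in_natural (fun l => ihoch i n (corep E k') (l.+1 + m)%N)
   (fun l => ihoch i n (corep E k) (l.+1 + m)%N) (fun l => precomp i n k k' (l.+1 + m)%N phi)) => l'.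
exact: bi0r.
Qed.

Lemma ilift_fpre n m (h : forall k, biadd (Phi k) (ihoch i n (corep E k) m) W) :
  (forall k k' a (phi : mor E k k') xi,
     h k a (precomp i n k k' m phi xi) = h k' (fact a phi) xi) ->
  forall k a xi, ilift h (fpre i Phi n k m a xi) = h k a xi.
Proof.
elim: n m h => [|n IHn] m h hb k a xi.
  rewrite -[LHS]/(h m (fact a xi) (idm m)) -hb.
  by rewrite -[X in h k a X]/(compm xi (idm m)) (compm_idr (prop_dgcat E)).
move: xi; apply: (@dsum_ind (fun l => ihoch i n (corep E k) (l.+1 + m)%N))
  => [|xi xi' e e'|j xi].
- by rewrite !bi0r raddf0.
- by rewrite !biaddr raddfD e e'.
rewrite -dsum_in_fpre [LHS]dsum_out_in IHn // => {k a xi} k k' a phi xi.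
by rewrite -[LHS]/(h k a (dsum_in _ j _)) dsum_in_precomp hb.
Qed.

End CoYoneda.

(** * The action of an extension *)

Section ExtAction.
Variables (E : prop) (i : ainf_mult E) (T : extension i).
Implicit Types x y z : nat * nat.

Lemma ext_dgcat : is_dgcat T.
Proof. exact: mon_dgcat (ext_moncat T). Qed.

Lemma ext_incl_bij k y : bijective (ext_incl T (k, 0%N) y).
Proof.
exists (fun g => sval (cid (ext_surj g))) => [f|g]; last by case: cid.
by case: cid => f' /= /ext_inj.
Qed.

(** Reads a morphism of T out of [k; 0] back as a core morphism, so that xi ; f is again one in
    [ext_comp_core]. *)
Definition ext_proj k y : {additive mor T (k, 0%N) y -> core_hom i (k, 0%N) y} :=
  s2val (bij_additive (ext_incl_bij k y)).
Lemma ext_inclK k y : cancel (ext_incl T (k, 0%N) y) (ext_proj k y).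
Proof. by rewrite /ext_proj; case: bij_additive. Qed.
Lemma ext_projK k y : cancel (ext_proj k y) (ext_incl T (k, 0%N) y).
Proof. by rewrite /ext_proj; case: bij_additive. Qed.

Definition ext_comp_core k x y :
    biadd (core_hom i (k, 0%N) x) (mor T x y) (core_hom i (k, 0%N) y) :=
  bi_post (ext_proj k y) (bi_pre (ext_incl T (k, 0%N) x) idfun (@compm _ T (k, 0%N) x y)).

Lemma ext_comp_coreE k x y xi f : ext_comp_core k x y xi f =
  ext_proj k y (compm (ext_incl T (k, 0%N) x xi) f).
Proof. by []. Qed.

Lemma ext_comp_core_bichain k x y : bichain (ext_comp_core k x y).
Proof.
apply: bichain_post.
  apply: (chainp_inv (@ext_inclK k y) (@ext_projK k y)).
  exact: chain_map_prop.
apply: bichain_pre (id_chain _) _; first exact: chain_map_prop.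
exact: compm_chain ext_dgcat _ _ _.
Qed.

Variable Phi : functor_data E.
Hypothesis Pf : is_functor Phi.

Definition fpre_obj k y : biadd (Phi k) (core_hom i (k, 0%N) y) (ihoch i y.2 Phi y.1) :=
  fpre i Phi y.2 k y.1.

Definition ext_act_gen x y (f : mor T x y) k :
    biadd (Phi k) (ihoch i x.2 (corep E k) x.1) (ihoch i y.2 Phi y.1) :=
  bi_pre idfun (bi_l (ext_comp_core k x y) f) (fpre_obj k y).

Definition ext_act_fun x y (u : ihoch i x.2 Phi x.1) (f : mor T x y) :
  ihoch i y.2 Phi y.1 := ilift (ext_act_gen f) u.

(** The family sending a, xi to a . (xi ; f) is compatible with E because composition in T is
    associative: (phi ; xi) ; f = phi ; (xi ; f). *)
Lemma ext_act_funE x y (f : mor T x y) k a xi :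
  ext_act_fun (fpre_obj k x a xi) f = fpre_obj k y a (ext_comp_core k x y xi f).
Proof.
apply: (ilift_fpre (h := ext_act_gen f)) => {a xi} k k' a phi xi.
rewrite -[RHS]/(fpre_obj k' y (fact a phi) (ext_comp_core k' x y xi f)).
rewrite -[LHS]/(fpre_obj k y a (ext_comp_core k x y _ f)).
rewrite /fpre_obj (fpre_fact Pf); congr (fpre _ _ _ _ _ _ _).
rewrite !ext_comp_coreE; apply: (can_inj (@ext_inclK k y)); rewrite ext_projK.
(* [precomp] is composition in the core category, which the inclusion into T preserves. *)
rewrite -[X in ext_incl T _ _ X]/(@compm _ (core i) (k, 0%N) (k', 0%N) x phi xi).
rewrite -[X in _ = ext_incl T _ _ X]/(@compm _ (core i) (k, 0%N) (k', 0%N) y phi _).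
by rewrite !ext_comp ext_projK (compmA ext_dgcat).
Qed.

Lemma ext_act_subproofl x y (f : mor T x y) :
  {morph (fun u => ext_act_fun u f) : u v / u + v}.
Proof. exact: raddfD. Qed.
Lemma ext_act_subproofr x y u :
  {morph (fun f : mor T x y => ext_act_fun u f) : f g / f + g}.
Proof.
move=> f g; move: u; apply: (ihoch_ind Pf) => [|u v eu ev|k a xi].
- have e0 (h : mor T x y) : ext_act_fun 0 h = 0 by exact: (raddf0 (ilift (ext_act_gen h))).
  by rewrite !e0 addr0.
- by rewrite !ext_act_subproofl eu ev addrACA.
by rewrite !(@ext_act_funE x y _ k) biaddr [LHS]biaddr.
Qed.

Definition ext_act x y : biadd (ihoch i x.2 Phi x.1) (mor T x y) (ihoch i y.2 Phi y.1) :=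
  Biadd (@ext_act_subproofl x y) (@ext_act_subproofr x y).

Lemma ext_actE x y f k a xi :
  ext_act x y (fpre_obj k x a xi) f = fpre_obj k y a (ext_comp_core k x y xi f).
Proof. exact: ext_act_funE. Qed.

Lemma ext_act_bichain x y : bichain (ext_act x y).
Proof.
have fc k z : bichain (fpre_obj k z) by apply: fpre_bichain.
have cc k := ext_comp_core_bichain k x y.
split=> [p q u f hu hf|u f].
  (* With u replaced by [pr p u] the claim is additive in u; on a homogeneous pairing this
     projection is the identity or 0. *)
  rewrite -hu; move: u {hu}; apply: (ihoch_homog_ind Pf) => [|u v eu ev|k r s a xi ha hxi].
  - by rewrite raddf0 bi0l; apply: homog0.
  - by rewrite raddfD biaddl; apply: homogD.
  rewrite (pr_homog _ (bichain_homog (fc k x) ha hxi)).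
  case: eqP => [->|_]; last by rewrite bi0l; apply: homog0.
  rewrite (ext_actE f a xi) -addrA; apply: (bichain_homog (fc k y) ha).
  exact: (bichain_homog (cc k) hxi hf).
move: u; apply: (ihoch_ind Pf) => [|u v eu ev|k a xi].
- by rewrite !raddf0 !bi0l raddf0 addr0.
- by rewrite !raddfD !biaddl raddfD eu ev addrACA.
rewrite [X in df X](ext_actE f a xi) (bichain_df (fc k y)) (bichain_df (fc k x) a xi).
rewrite -(bi_eps (bichain_homog (fc k x)) a xi) biaddl.
rewrite [X in _ = X + _ + _](ext_actE f) [X in _ = _ + X + _](ext_actE f).
by rewrite [X in _ = _ + X](ext_actE (df f)) (bichain_df (cc k)) biaddr addrA.
Qed.

(** On generators both sides are a . (xi ; f ; g). *)
Lemma ext_actA x y z u (f : mor T x y) (g : mor T y z) :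
  ext_act y z (ext_act x y u f) g = ext_act x z u (compm f g).
Proof.
move: u; apply: (ihoch_ind Pf) => [|u v eu ev|k a xi]; first by rewrite !bi0l.
  by rewrite !biaddl eu ev.
rewrite [X in ext_act y z X]ext_actE [LHS]ext_actE [RHS]ext_actE.
by congr (fpre_obj _ _ _ _); rewrite !ext_comp_coreE ext_projK (compmA ext_dgcat).
Qed.

Lemma ext_act1 x u : ext_act x x u (idm x) = u.
Proof.
move: u; apply: (ihoch_ind Pf) => [|u v eu ev|k a xi]; first by rewrite !bi0l.
  by rewrite !biaddl eu ev.
rewrite [LHS]ext_actE; congr (fpre_obj _ _ _ _).
by rewrite ext_comp_coreE (compm_idr ext_dgcat) ext_inclK.
Qed.

(** Writing u as u . id reduces the claim to id ; f = f. *)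
Lemma ext_act_prop m1 m2 u (f : mor E m1 m2) :
  ext_act (m1, 0%N) (m2, 0%N) u (ext_incl T (m1, 0%N) (m2, 0%N) f) = fact u f.
Proof.
rewrite -[in LHS](fact_id Pf u) -[X in ext_act _ _ X]/(fpre_obj m1 (m1, 0%N) u (idm m1)).
rewrite ext_actE ext_comp_coreE.
rewrite -[X in ext_incl T _ _ X]/(@idm _ (core i) (m1, 0%N)) ext_id.
by rewrite (compm_idl ext_dgcat) ext_inclK.
Qed.

End ExtAction.

(** * Naturality of the action in the functor *)

Section ActionNatural.
Variables (E : prop) (i : ainf_mult E) (T : extension i).
Variables (Phi Psi : functor_data E) (theta : forall n, {additive Phi n -> Psi n}).
Hypotheses (Pf : is_functor Phi) (Qf : is_functor Psi).
Hypothesis thetaE : forall m n (a : Phi m) (f : mor E m n),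
  theta n (fact a f) = fact (theta m a) f.

Fixpoint ihoch_map n m : {additive ihoch i n Phi m -> ihoch i n Psi m} :=
  match n with
  | 0 => theta m
  | n'.+1 => hoch_map i (ihoch_map n') m
  end.

Lemma hcoef_map n m (u : ihoch i n.+1 Phi m) k :
  hcoef (ihoch_map n.+1 m u : hoch i (ihoch i n Psi) m) k =
  ihoch_map n (k.+1 + m)%N (hcoef (u : hoch i (ihoch i n Phi) m) k).
Proof. by []. Qed.

Lemma ihoch_map_fpre n k m a xi :
  ihoch_map n m (fpre i Phi n k m a xi) = fpre i Psi n k m (theta k a) xi.
Proof.
elim: n m xi => [|n IHn] m xi; first exact: thetaE.
by apply: (@hcoefP _ i (ihoch i n Psi) m) => j; rewrite hcoef_map !hcoef_fpre IHn.
Qed.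

(** On generators, theta sends a . xi to theta(a) . xi, and f only changes xi. *)
Lemma ext_act_natural x y u (f : mor T x y) :
  ext_act T Qf x y (ihoch_map x.2 x.1 u) f = ihoch_map y.2 y.1 (ext_act T Pf x y u f).
Proof.
move: u; apply: (ihoch_ind Pf) => [|u v eu ev|k a xi].
- by rewrite raddf0 !bi0l raddf0.
- by rewrite raddfD !biaddl raddfD eu ev.
rewrite ihoch_map_fpre [LHS]ext_actE [X in ihoch_map _ _ X]ext_actE.
by rewrite ihoch_map_fpre.
Qed.

End ActionNatural.

(** * Hochschild complexes of algebras *)

Lemma bi_lE (X Y Z : zmodType) (f : biadd X Y Z) y x : bi_l f y x = f x y.
Proof. by []. Qed.

(** * Identity casts and their action *)

Section Idcast.
Variables (O : Type) (D : dgcat_data O).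
Hypothesis Dc : is_dgcat D.
Implicit Types x y : O.

Lemma idcast_homog x y (e : x = y) : homog 0 (idcast D e).
Proof. by case: y / e; apply: idm_homog. Qed.
Lemma idcast_df x y (e : x = y) : df (idcast D e) = 0.
Proof. by case: y / e; apply: idm_df. Qed.
Lemma idcastK x y (e : x = y) : compm (idcast D e) (idcast D (esym e)) = idm x.
Proof. by case: y / e; apply: compm_idl. Qed.
Lemma idcastKV x y (e : x = y) : compm (idcast D (esym e)) (idcast D e) = idm y.
Proof. by case: y / e; apply: compm_idl. Qed.

End Idcast.

Section FunctorTheory.
Variables (E : prop) (Phi : functor_data E).
Hypothesis Pf : is_functor Phi.

Lemma fact_cycle_chain m n (f : mor E m n) : homog 0 f -> df f = 0 ->
  chain_prop (bi_l (@fact _ Phi m n) f).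
Proof.
move=> hf f0; have fc := fact_chain Pf m n; split=> [p x hx|x].
  by rewrite -[p]addr0; apply: (bichain_homog fc).
by rewrite [RHS](bichain_df fc) f0 bi0r addr0.
Qed.

Lemma fact_idcast_bij m n (e : m = n) : bijective (bi_l (@fact _ Phi m n) (idcast E e)).
Proof.
exists (bi_l (@fact _ Phi n m) (idcast E (esym e))) => x /=.
  by rewrite -(fact_comp Pf) (idcastK (prop_dgcat E)) (fact_id Pf).
by rewrite -(fact_comp Pf) (idcastKV (prop_dgcat E)) (fact_id Pf).
Qed.

End FunctorTheory.

(** * Multiplication by one Hochschild factor *)

Section AlgebraProduct.
Variables (E : prop) (i : ainf_mult E) (A : algebra E).
Let Af := alg_functor A.
Let Em := prop_moncat (prop_axioms E).
Let Ed := prop_dgcat E.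

(** No sign arises, since the morphism that passes y is an identity, of degree 0. *)
Lemma mu_natr m m' n' x y (g : mor E m' n') :
  fact (alg_mu A m m' x y) (tens (idm m) g) = alg_mu A m n' x (fact y g).
Proof.
elim/homog_ind: y => [|y y' e e'|p y hy]; first by rewrite !(bi0r, bi0l).
  by rewrite biaddr !biaddl e e' biaddr.
rewrite (alg_mu_nat x g hy (idm_homog Ed m)) (fact_id Af).
by rewrite /ksign muln0 expr0 mulr1z.
Qed.

Lemma mu_natl m n m' p q x y (f : mor E m n) : homog p y -> homog q f ->
  fact (alg_mu A m m' x y) (tens f (idm m')) = alg_mu A n m' (fact x f) y *~ ksign p q.
Proof. by move=> hy hf; rewrite (alg_mu_nat x (idm m') hy hf) (fact_id Af). Qed.

(** The components of C(A, A) = C(Phi)(0) are Phi(k + 1 + 0), and [k.+1 + 0] is not convertible to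
    [k.+1]; this identity removes the 0. *)
Definition cast0 k m : mor E (k.+1 + 0 + m)%N (k.+1 + m)%N :=
  idcast E (esym (addnA k.+1 0 m)).

Lemma tens_idm0 m n (g : mor E m n) : tens (idm 0%N) g = g :> mor E m n.
Proof.
have := tens_unitl Em g (erefl m) (erefl n).
by rewrite (compm_idr Ed) (compm_idl Ed).
Qed.

Lemma cast0_natr k m m' (g : mor E m m') :
  compm (cast0 k m) (tens (idm k.+1) g) = compm (tens (idm (k.+1 + 0)%N) g) (cast0 k m').
Proof.
have := tensA Em (idm k.+1) (idm 0%N) g (esym (addnA k.+1 0 m)) (esym (addnA k.+1 0 m')).
by rewrite (tens_id Em) tens_idm0 => ->.
Qed.

Lemma cast0_fLm n k m :
  compm (cast0 n m) (fLm i n k m) = compm (tens (fLm i n k 0) (idm m)) (cast0 k m).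
Proof.
have := tensA Em (i n.+1 k.+1 (fL n.+1 k.+1)) (idm 0%N) (idm m)
  (esym (addnA n.+1 0 m)) (esym (addnA k.+1 0 m)).
by rewrite tens_idm0 => ->.
Qed.

Lemma fLm_homog n k m : homog (n%:Z - k%:Z - 1) (fLm i n k m).
Proof.
rewrite -[X in homog X]addr0; apply: (bichain_homog (tens_chain Em _ _ _ _)).
  have -> : n%:Z - k%:Z - 1 = n.+1%:Z - k.+1%:Z - 1 by lia.
  by apply: (chainp_homog (chain_map_prop (i n.+1 k.+1))); apply: fL_homog.
exact: idm_homog.
Qed.

Lemma cast0_chain k m : chain_prop (bi_l (@fact _ A _ _) (cast0 k m)).
Proof. by apply: fact_cycle_chain; [|apply: idcast_homog|apply: idcast_df]. Qed.

(* (x (x) l_(k+1)) . y = (-1)^(k|y|) (x . y) (x) l_(k+1) *)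
Definition hoch_mul0 m : biadd (hoch i A 0%N) (A m) (hoch i A m) :=
  dsum_bil (fun k => bi_post (bi_l (@fact _ A _ _) (cast0 k m))
    (bi_pre idfun (epsn _ k) (alg_mu A (k.+1 + 0)%N m))).

Lemma hcoef_mul0 m x y k : hcoef (hoch_mul0 m x y) k =
  fact (alg_mu A (k.+1 + 0)%N m (hcoef x k) (epsn _ k y)) (cast0 k m).
Proof. by []. Qed.

(** Both sides carry the sign (-1)^(k(|y| + |g|)) of moving l_(k+1) past y and g. *)
Lemma hoch_mul0_rlinear : rlinear hoch_mul0.
Proof.
move=> m m' x y g; apply: (@hcoefP _ i A) => k; rewrite hcoef_act !hcoef_mul0.
rewrite -(fact_comp Af) cast0_natr (fact_comp Af) mu_natr.
by rewrite (bi_epsn (bichain_homog (fact_chain Af _ _))).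
Qed.

(** In each component this is the splitting isomorphism of A, up to the sign involution on y and an
    identity cast. *)
Lemma hoch_mul0_bij m : bijective (tlift (hoch_mul0 m)).
Proof.
apply: tlift_dsum_bil_bij => k.
have b1 : bijective (bi_l (@fact _ A _ _) (cast0 k m)) by apply: fact_idcast_bij.
have b2 : bijective (tmap (idfun : {additive A (k.+1 + 0)%N -> _}) (epsn (A m) k)).
  by apply: tmap_bij; [exists idfun|exists (epsn _ k); apply: epsnK].
apply: (eq_bij (bij_comp b1 (bij_comp (alg_split A (k.+1 + 0)%N m) b2))).
elim/ztens_ind => [|x y t IHt]; first by rewrite /comp !raddf0.
rewrite [RHS]raddfD -IHt /comp !raddfD; congr (_ + _).
by rewrite tmapE !tliftE.
Qed.

Lemma hoch_mul0_bichain m : bichain (hoch_mul0 m).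
Proof.
split=> [p q x y hx hy|x y].
  apply/hcoef_homog => k; rewrite hcoef_mul0.
  apply: (chainp_homog (cast0_chain k m)).
  have -> : p + q - k%:Z = (p - k%:Z) + q by rewrite addrAC.
  apply: (bichain_homog (alg_mu_chain A _ _)); last exact: homog_epsn.
  by move/hcoef_homog: hx.
elim/homog_ind: y => [|y y' e e'|q y hy]; first by rewrite !(bi0r, raddf0) addr0.
  by rewrite !(biaddr, raddfD) e e' addrACA.
have dy : homog (q - 1) (df y) by rewrite /homog -(df_pr (fob_complex Af m)) hy.
have [N xN] := hcoef_fin x; apply: hcoefP => k; rewrite hcoefD.
have z0 n : hcoef x n = 0 -> hcoef (hoch_mul0 m x y) n = 0.
  by move=> e; rewrite hcoef_mul0 e !bi0l.
rewrite (hcoef_df _ (N := N)) => [|n /xN/z0 //].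
rewrite !hcoef_mul0 (hcoef_df _ (N := N)) // hcoef_eps.
rewrite -[X in df X]/(bi_l (@fact _ A _ _) (cast0 k m) _) -(chainp_df (cast0_chain k m)).
rewrite (bichain_df (alg_mu_chain A _ _)) raddfD biaddl [X in _ = X + _]biaddl.
rewrite -[LHS]addrA -[RHS]addrA; congr (_ + _); rewrite [LHS]addrC; congr (_ + _).
  rewrite bi_suml [RHS]bi_suml; apply: eq_bigr => n _; rewrite hcoef_mul0.
  rewrite -[X in eps _ X]/(bi_l (@fact _ A _ _) (cast0 n m) _).
  rewrite -(chainp_eps (chainp_homog (cast0_chain n m))) bi_lE.
  rewrite -(bi_eps (bichain_homog (alg_mu_chain A _ _))).
  rewrite -(fact_comp Af) cast0_fLm (fact_comp Af).
  rewrite (mu_natl _ (homog_eps (homog_epsn n hy)) (fLm_homog n k 0)).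
  rewrite (eps_homog (homog_epsn n hy)) !(epsn_homog _ hy).
  rewrite !bi_mulzr !bi_mulzl -!mulrzA; congr (_ *~ _).
  rewrite -ksgnM -!ksgnD.
  (* On the left, l_(n+1) passes y, [eps] acts on y, and a forest of degree n - k - 1 passes y; on
     the right, l_(k+1) passes y. The exponents differ by the even number 2q(n - k). *)
  have -> : n%:Z * q + (q + q * (n%:Z - k%:Z - 1)) =
    k%:Z * q + (q * (n%:Z - k%:Z) + q * (n%:Z - k%:Z)) by ring.
  by rewrite ksgnD [X in _ * X]ksgnD ksgn_sqr mulr1.
(* In the terms with [df y], l_(k+1) passes an element of degree q - 1; the missing k in the
   exponent is the degree of l_(k+1) counted in [eps] of x. *)
rewrite bi_lE (epsn_homog _ hy) (epsn_homog _ dy) raddfMz !bi_mulzr !bi_mulzl -!mulrzA.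
by rewrite -ksgnD; congr (_ *~ ksgn _); ring.
Qed.

(** The new factor becomes the innermost one of the iterate; the outer ones are carried along
    componentwise. *)
Fixpoint hoch_mul n m : biadd (hoch i A 0%N) (ihoch i n A m) (ihoch i n.+1 A m) :=
  match n with
  | 0 => hoch_mul0 m
  | n'.+1 => hoch_bir i (hoch_mul n') m
  end.

Lemma hoch_mul_rlinear n : rlinear (hoch_mul n).
Proof.
by elim: n => [|n IHn]; [apply: hoch_mul0_rlinear|apply: hoch_bir_rlinear].
Qed.

Lemma hoch_mul_bichain n m : bichain (hoch_mul n m).
Proof.
elim: n m => [|n IHn] m; first exact: hoch_mul0_bichain.
by apply: hoch_bir_bichain => //; apply: hoch_mul_rlinear.
Qed.

Lemma hoch_mul_bij n m : bijective (tlift (hoch_mul n m)).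
Proof.
by elim: n m => [|n IHn] m; [apply: hoch_mul0_bij|apply: hoch_bir_bij].
Qed.

End AlgebraProduct.

Lemma deg0_homog (A : zmodType) (p : int) (x : deg0 A) : homog p x -> p <> 0 -> x = 0.
Proof.
move=> hx /eqP/negPf p0; rewrite -hx.
by rewrite -[LHS]/(if p == 0 then x else 0) p0.
Qed.

(** * Tensor powers as iterated Hochschild complexes *)

Section Identification.
Variables (E : prop) (i : ainf_mult E) (A : algebra E).

Lemma alg_powerS m : alg_power A m.+1 =
  tlift (bi_pre idfun (alg_power A m) (alg_mu A 1%N m)).
Proof. by []. Qed.

Lemma alg_power_chain m : chain_prop (alg_power A m : {additive tpow (A 1%N) m -> A m}).
Proof.
elim: m => [|m IHm].
  split=> [p k hk|k].
    rewrite -[alg_power A 0 k]/(alg_one A *~ k).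
    have [p0|/eqP p0] := eqVneq p 0; last by rewrite (deg0_homog hk p0) mulr0z; apply: homog0.
    by apply: homogMz; rewrite p0; apply: alg_one_homog.
  rewrite -[LHS]/(alg_one A *~ 0) -[X in df X]/(alg_one A *~ k).
  by rewrite mulr0z raddfMz (alg_one_df A) mul0rz.
exact: (tlift_chain (bichain_pre (id_chain _) IHm (alg_mu_chain A 1 m))).
Qed.

Lemma alg_power_bij m : bijective (alg_power A m).
Proof.
elim: m => [|m IHm]; first exact: (alg_split1 A).
have b : bijective (tmap (idfun : {additive A 1%N -> _}) (alg_power A m)).
  by apply: tmap_bij => //; exists idfun.
apply: (eq_bij (bij_comp (alg_split A 1 m) b)) => t.
rewrite alg_powerS -[LHS]/(tlift _ (tmap _ _ t)).
elim/ztens_ind: t => [|x y t IHt]; first by rewrite !raddf0.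
by rewrite !raddfD IHt tmapE !tliftE.
Qed.

Lemma HH0_powerE m (k : int) t :
  HH0_power i A m (tpair (deg0 int) (tpow (A 1%N) m) k t) = alg_power A m t *~ k.
Proof. exact: tliftE. Qed.

Lemma HH0_power_chain m : chain_prop (HH0_power i A m : {additive HH i A (m, 0%N) -> A m}).
Proof.
apply: tlift_chain; split=> [p q k t hk ht|k t].
  rewrite -[X in homog _ X]/(alg_power A m t *~ k).
  have [p0|/eqP p0] := eqVneq p 0; last by rewrite (deg0_homog hk p0) mulr0z; apply: homog0.
  by rewrite p0 add0r; apply: homogMz; apply: (chainp_homog (alg_power_chain m)).
rewrite -[X in df X]/(alg_power A m t *~ k).
rewrite -[X in _ = X + _]/(alg_power A m t *~ 0).
rewrite -[X in _ = _ + X]/(alg_power A m (df t) *~ _).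
rewrite mulr0z add0r raddfMz -(chainp_df (alg_power_chain m)); congr (_ *~ _).
have k0 : homog 0 (k : deg0 int) by [].
by rewrite (eps_homog k0) mulr1z.
Qed.

Lemma HH0_power_bij m : bijective (HH0_power i A m).
Proof.
have [g gK Kg] := bij_additive (alg_power_bij m).
(* The empty tensor power of C(A, A) is Z, and the inverse uses its generator 1. *)
exists (fun a => tpair (deg0 int) (tpow (A 1%N) m) 1 (g a)) => [t|a]; last first.
  by rewrite HH0_powerE mulr1z.
elim/ztens_ind: t => [|k t u IHu]; first by rewrite !raddf0 bi0r.
rewrite !raddfD biaddr IHu; congr (_ + u).
rewrite HH0_powerE raddfMz gK bi_mulzr -bi_mulzl; congr (tpair _ _ _ _).
exact: intz.
Qed.

Let C := hoch i A 0%N.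
Let A1 := A 1%N.

(** Reassociation splits off the first Hochschild factor, the rest is identified recursively, and
    [hoch_mul] puts the factor back. *)
Fixpoint HH_ihoch n m : {additive tensor (tpow C n) (tpow A1 m) -> ihoch i n A m} :=
  match n with
  | 0 => HH0_power i A m
  | n'.+1 => (tlift (hoch_mul i A n' m) \o
      (tmap idfun (HH_ihoch n' m) \o tassoc C (tpow C n') (tpow A1 m)))
  end.

Lemma HH_ihochS n m t : HH_ihoch n.+1 m t =
  tlift (hoch_mul i A n m) (tmap (idfun : {additive C -> C}) (HH_ihoch n m)
    (tassoc C (tpow C n) (tpow A1 m) t)).
Proof. by []. Qed.

Lemma HH_ihoch_chain n m : chain_prop (HH_ihoch n m).
Proof.
elim: n => [|n IHn]; first exact: HH0_power_chain.
have c1 := tmap_chain (id_chain C) IHn.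
have c2 := tlift_chain (hoch_mul_bichain i A n m).
have c3 := tassoc_chain C (tpow C n) (tpow A1 m).
split=> [p t ht|t]; rewrite !HH_ihochS.
  exact/(chainp_homog c2)/(chainp_homog c1)/(chainp_homog c3).
by rewrite (chainp_df c3) (chainp_df c1) (chainp_df c2).
Qed.

Lemma HH_ihoch_bij n m : bijective (HH_ihoch n m).
Proof.
elim: n => [|n IHn]; first exact: HH0_power_bij.
have b1 : bijective (tmap (idfun : {additive C -> C}) (HH_ihoch n m)).
  by apply: tmap_bij => //; exists idfun.
exact: bij_comp (hoch_mul_bij i A n m) (bij_comp b1 (tassoc_bij _ _ _)).
Qed.

Definition ihoch_HH n m : {additive ihoch i n A m -> tensor (tpow C n) (tpow A1 m)} :=
  s2val (bij_additive (HH_ihoch_bij n m)).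
Lemma HH_ihochK n m : cancel (HH_ihoch n m) (ihoch_HH n m).
Proof. by rewrite /ihoch_HH; case: bij_additive. Qed.
Lemma ihoch_HHK n m : cancel (ihoch_HH n m) (HH_ihoch n m).
Proof. by rewrite /ihoch_HH; case: bij_additive. Qed.
Lemma ihoch_HH_chain n m : chain_prop (ihoch_HH n m).
Proof. exact: chainp_inv (@HH_ihochK n m) (@ihoch_HHK n m) (HH_ihoch_chain n m). Qed.

End Identification.

(** * Naturality of the identification in the algebra *)

Section IdentificationNatural.
Variables (E : prop) (i : ainf_mult E) (A B : algebra E) (theta : alg_hom A B).

Let th n : {additive A n -> B n} := theta n.
Let th_fact : forall m n (a : A m) (f : mor E m n), th n (fact a f) = fact (th m a) f :=
  alg_map_nat theta.

Lemma th_chain n : chain_prop (th n).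
Proof. exact: chain_map_prop. Qed.

Lemma hoch_mul_natural n m x y :
  ihoch_map i th n.+1 m (hoch_mul i A n m x y) =
  hoch_mul i B n m (hoch_map i th 0%N x) (ihoch_map i th n m y).
Proof.
elim: n m y => [|n IHn] m y.
  apply: (@hcoefP _ i B) => k.
  rewrite -[LHS]/(th _ (hcoef (hoch_mul0 i A m x y) k)) !hcoef_mul0 th_fact.
  congr (fact _ _); rewrite [LHS](alg_map_mu theta); congr (alg_mu _ _ _ _ _).
  rewrite /epsn; case: ifP => // _.
  exact: (chainp_eps (chainp_homog (th_chain m))).
by apply: (@hcoefP _ i (ihoch i n.+1 B) m) => k; rewrite hcoef_map [X in ihoch_map _ _ _ _ X]hcoef_bir IHn.
Qed.

Lemma alg_power_natural m t :
  th m (alg_power A m t) = alg_power B m (tpow_map (th 1%N) m t).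
Proof.
elim: m t => [|m IHm] t.
  rewrite -[X in th _ X]/(alg_one A *~ t) raddfMz.
  by rewrite -[RHS]/(alg_one B *~ t); congr (_ *~ _); apply: alg_map_one.
elim/ztens_ind: t => [|a t v IHv]; first by rewrite !raddf0.
rewrite !raddfD; congr (_ + _); last exact: IHv.
rewrite tmapE !alg_powerS !tliftE.
rewrite [LHS](alg_map_mu theta).
by rewrite -[RHS]/(alg_mu B 1%N m (th 1%N a) (alg_power B m (tpow_map (th 1%N) m t))) -IHm.
Qed.

Lemma HH_ihoch_natural n m (u : HH i A (m, n)) :
  ihoch_map i th n m (HH_ihoch i A n m u) = HH_ihoch i B n m (HH_map i theta (m, n) u).
Proof.
rewrite -[HH_map _ _ _ _]/(tmap (tpow_map (hoch_map i th 0%N) n) (tpow_map (th 1%N) m) u).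
elim: n u => [|n IHn] u.
  elim/ztens_ind: u => [|k t u IHu]; first by rewrite !raddf0.
  rewrite !raddfD; congr (_ + _); first last.
    exact: IHu.
  rewrite tmapE [X in ihoch_map _ _ _ _ X]HH0_powerE [RHS]HH0_powerE raddfMz; congr (_ *~ _).
  exact: alg_power_natural.
(* The left factor is itself a tensor power, so two inductions are needed to reach pure tensors of
   the form (c (x) s) (x) t. *)
elim/ztens_ind: u => [|ct t u IHu]; first by rewrite !raddf0.
rewrite !raddfD; congr (_ + _); last exact: IHu.
elim/ztens_ind: ct => [|c s ct IHs]; first by rewrite bi0l !raddf0.
rewrite biaddl !raddfD; congr (_ + _); last exact: IHs.
rewrite !HH_ihochS [X in tmap _ _ X]tassocE tmapE.
rewrite [X in ihoch_map _ _ _ _ X]tliftE hoch_mul_natural IHn.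
rewrite [X in tassoc (hoch i B 0%N) _ _ X]tmapE.
rewrite [X in tpair (tpow (hoch i B 0%N) n.+1) _ X _]tmapE.
rewrite [X in _ = tlift _ (tmap _ _ X)]tassocE [X in _ = tlift _ X]tmapE [RHS]tliftE.
by rewrite [X in HH_ihoch _ _ _ _ X]tmapE.
Qed.

End IdentificationNatural.

(** * The action on Hochschild complexes of algebras *)

Section HHAction.
Variables (E : prop) (i : ainf_mult E) (T : extension i) (A : algebra E).

Definition HH_act x y : biadd (HH i A x) (mor T x y) (HH i A y) :=
  bi_post (ihoch_HH i A y.2 y.1)
    (bi_pre (HH_ihoch i A x.2 x.1) idfun (ext_act T (alg_functor A) x y)).

Lemma HH_actE x y u f : HH_act x y u f =
  ihoch_HH i A y.2 y.1 (ext_act T (alg_functor A) x y (HH_ihoch i A x.2 x.1 u) f).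
Proof. by []. Qed.

Lemma HH_act_bichain x y : bichain (HH_act x y).
Proof.
apply: (bichain_post (ihoch_HH_chain i A y.2 y.1)).
exact: bichain_pre (HH_ihoch_chain i A x.2 x.1) (id_chain _) (ext_act_bichain T _ x y).
Qed.

Definition HH_act_map x y : chain_map (tensor (HH i A x) (mor T x y)) (HH i A y) :=
  chain_of (tlift_chain (HH_act_bichain x y)).

Lemma HH_act_mapE x y u f : HH_act_map x y (tpair _ _ u f) = HH_act x y u f.
Proof. exact: tliftE. Qed.

End HHAction.

Theorem mainTheorem1 (E : prop) (i : ainf_mult E) (T : extension i) :
  exists act : forall (A : algebra E) (x y : nat * nat),
      chain_map (tensor (HH i A x) (mor T x y)) (HH i A y),
  [/\ (* naturality in A *)
      forall (A B : algebra E) (theta : alg_hom A B) (x y : nat * nat)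
          (u : HH i A x) (f : mor T x y),
        act B x y (tpair _ _ (HH_map i theta x u) f) =
        HH_map i theta y (act A x y (tpair _ _ u f)),
      (* associativity *)
      forall (A : algebra E) (x y z : nat * nat)
          (u : HH i A x) (f : mor T x y) (g : mor T y z),
        act A y z (tpair _ _ (act A x y (tpair _ _ u f)) g) =
        act A x z (tpair _ _ u (compm f g)),
      (* unitality *)
      forall (A : algebra E) (x : nat * nat) (u : HH i A x),
        act A x x (tpair _ _ u (idm x)) = u &
      (* E acts on the tensor powers of A through the structure of A *)
      forall (A : algebra E) (m1 m2 : nat)
          (u : HH i A (m1, 0%N)) (f : mor E m1 m2),
        HH0_power i A m2
          (act A (m1, 0%N) (m2, 0%N)
            (tpair _ _ u (ext_incl T (m1, 0%N) (m2, 0%N) f))) =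
        fact (HH0_power i A m1 u) f].
Proof.
exists (fun A x y => HH_act_map T A x y); split.
- move=> A B theta [m n] [m' n'] u f; rewrite !HH_act_mapE !HH_actE.
  apply: (can_inj (@HH_ihochK _ i B n' m')); rewrite ihoch_HHK.
  rewrite -(HH_ihoch_natural theta) ihoch_HHK -(HH_ihoch_natural theta).
  exact: (ext_act_natural (alg_functor A) (alg_functor B) (alg_map_nat theta) (x := (m, n)) (y := (m', n'))).
(* Between two consecutive actions the identification and its inverse cancel. *)
- by move=> A x y z u f g; rewrite !HH_act_mapE !HH_actE ihoch_HHK ext_actA.
- by move=> A x u; rewrite HH_act_mapE HH_actE ext_act1 HH_ihochK.
move=> A m1 m2 u f; rewrite HH_act_mapE HH_actE ext_act_prop.
(* Without Hochschild factors [HH_ihoch] is [HH0_power] by definition. *)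
exact: (@ihoch_HHK _ i A 0 m2).
Qed.
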